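(* Let $0<\alpha<mn$ and let $T_\alpha^m$ be a multilinear fractional operator whose kernel $K_\alpha$ satisfies the size condition and the smoothness condition (with exponent $0<\gamma\le 1$) stated in the context. Let $0<\delta<\min\{\gamma,mn-\alpha\}$, $\tilde\alpha=\alpha+\delta$, and let $\vec p=(p_1,\dots,p_m)$ be a vector of exponents, $1\le p_i\le\infty$, with $p>n/\tilde\alpha$. Let $\bm b=(b_1,\dots,b_m)$ with $b_i\in\Lambda(\delta)$ for $1\le i\le m$. Let $\tilde\delta\le\delta$ and let $(w,\vec v)$ be a pair of weights in $\mathcal H_m(\vec p,\tilde\alpha,\tilde\delta)$ (the class defined in the context with $\beta=\tilde\alpha$ and with the same parameter $\delta$) such that $v_i^{-p_i'}\in \mathrm{RH}_m$ for every $i$ with $1<p_i\le\infty$. Then the multilinear commutator $T_{\alpha,\bm b}^m$ is bounded from $\prod_{i=1}^m L^{p_i}(v_i^{p_i})$ to $\mathcal L_w(\tilde\delta)$, that is, there exists a positive constant $C$ such that $$\frac{1}{w^{-1}(B)|B|^{\tilde\delta/n}}\int_B \left|T_{\alpha,\bm b}^m\vec f(x)-(T_{\alpha,\bm b}^m\vec f)_B\right|dx\le C\prod_{i=1}^m\|f_iv_i\|_{p_i}$$ for every ball $B\subset\mathbb R^n$ and every $\vec f=(f_1,\dots,f_m)$ such that $f_iv_i\in L^{p_i}$ for $1\le i\le m$.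
   Context: Notation. $m\in\mathbb N$; $1/p=\sum_{i=1}^m 1/p_i$; $p_i'$ is the conjugate exponent of $p_i$ ($1/p_i+1/p_i'=1$); $|B|$ is Lebesgue measure; $g_B=\frac1{|B|}\int_B g$; $w^{-1}(B)=\int_B w^{-1}$. A weight is a locally integrable function $w$ on $\mathbb R^n$ with $0<w(x)<\infty$ for almost every $x$; $\vec v=(v_1,\dots,v_m)$ is a vector of weights. $f\in L^{p_i}(v_i^{p_i})$ means $fv_i\in L^{p_i}$. Operators. For $0<\alpha<mn$, $$T_\alpha^m\vec f(x)=\int_{(\mathbb R^n)^m}K_\alpha(x,\vec y)\prod_{i=1}^m f_i(y_i)\,d\vec y,\qquad \vec y=(y_1,\dots,y_m).$$ Size condition: there is a constant $C$ with $|K_\alpha(x,\vec y)|\le C\left(\sum_{i=1}^m|x-y_i|\right)^{-(mn-\alpha)}$. Smoothness condition: for some $0<\gamma\le1$ and some fixed constants $C,c>0$, $$|K_\alpha(x,\vec y)-K_\alpha(x',\vec y)|\le C\frac{|x-x'|^\gamma}{\left(\sum_{i=1}^m|x-y_i|\right)^{mn-\alpha+\gamma}}\quad\text{whenever }\sum_{i=1}^m|x-y_i|>c|x-x'|.$$ Commutator. $T_{\alpha,\bm b}^m\vec f=\sum_{j=1}^m T_{\alpha,b_j}^m\vec f$, where $T_{\alpha,b_j}^m\vec f=b_jT_\alpha^m\vec f-T_\alpha^m(f_1,\dots,b_jf_j,\dots,f_m)$, formally represented by $$T_{\alpha,b_j}^m\vec f(x)=\int_{(\mathbb R^n)^m}(b_j(x)-b_j(y_j))K_\alpha(x,\vec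 y)\prod_{i=1}^mf_i(y_i)\,d\vec y.$$ Lipschitz symbols. For $0<\delta<1$, $b\in\Lambda(\delta)$ if there is $C$ with $|b(x)-b(y)|\le C|x-y|^\delta$ for all $x,y\in\mathbb R^n$. Weighted Lipschitz space. $\mathcal L_w(\tilde\delta)$ is the set of locally integrable $f$ with $\sup_B\frac{1}{w^{-1}(B)|B|^{\tilde\delta/n}}\int_B|f-f_B|<\infty$, the supremum over all balls $B$. Class of weights. Let $\delta,\beta,\tilde\delta$ be real with $0<\beta<mn$. $(w,\vec v)\in\mathcal H_m(\vec p,\beta,\tilde\delta)$ means that $w^{-1}$ is locally integrable and there are numbers $\beta_1,\dots,\beta_m$ with $0<\beta_i<n$, $\sum_{i=1}^m\beta_i=\beta$, and a constant $C>0$ such that $$\frac{|B|^{1+(\delta-\tilde\delta)/n}}{w^{-1}(B)}\prod_{i=1}^m\left\|\frac{v_i^{-1}}{(|B|^{1/n}+|x_B-\cdot|)^{n-\beta_i+\delta/m}}\right\|_{p_i'}\le C$$ for every ball $B=B(x_B,R)$. Reverse Hölder classes. For $1<s<\infty$, a weight $u\in\mathrm{RH}_s$ if there is $C$ with $\left(\frac1{|B|}\int_Bu^s\right)^{1/s}\le\frac{C}{|B|}\int_Bu$ for every ball $B$. For $m=1$ the condition $u\in\mathrm{RH}_1$ imposes no additional assumption.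
   Formalization: The commutator is taken modulo additive constants, through convergent integrals for its differences at two points, because its defining integral can diverge at every x for admissible f; where the literal integrals converge almost everywhere, the literal commutator is covered. *)

(* Defs.v *)
From HB Require Import structures.
From mathcomp Require Import all_boot all_order all_algebra.
From mathcomp Require Import all_classical all_reals all_analysis.
From mathcomp Require Import measurable_realfun ess_sup_inf.
From mathcomp Require Import ring.
Set Implicit Arguments.
Unset Strict Implicit.
Unset Printing Implicit Defensive.
Import Order.TTheory GRing.Theory Num.Theory.
Import numFieldNormedType.Exports.
Local Open Scope classical_set_scope.
Local Open Scope ring_scope.

(* The k-fold product of a sigma-finite measure, carried by k-tuples. *)
Section tuple_measure.
Context {d : measure_display} {T : measurableType d} {R : realType}.
Variable mu : {sigma_finite_measure set T -> \bar R}.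

Section cons_measure.
Variables (k : nat) (nu : {sigma_finite_measure set (k.-tuple T) -> \bar R}).

Definition pair_cons (z : T * k.-tuple T) : k.+1.-tuple T :=
  [tuple of z.1 :: z.2].

Definition tuple_uncons (t : k.+1.-tuple T) : T * k.-tuple T :=
  (thead t, [tuple of behead t]).

Lemma pair_consK : cancel pair_cons tuple_uncons.
Proof. by case=> x t; congr pair; apply: val_inj. Qed.

Lemma measurable_pair_cons : measurable_fun [set: _] pair_cons.
Proof. exact: measurable_cons. Qed.

Lemma measurable_tuple_uncons : measurable_fun [set: _] tuple_uncons.
Proof.
by apply/measurable_fun_pair; [exact: measurable_tnth|exact: measurable_behead].
Qed.

Definition cons_measure := pushforward (mu \x nu)%E pair_cons.

Let cons_measure0 : cons_measure set0 = 0%E.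
Proof. by rewrite /cons_measure /pushforward preimage_set0 measure0. Qed.

Let cons_measure_ge0 A : (0 <= cons_measure A)%E.
Proof. by rewrite /cons_measure /pushforward measure_ge0. Qed.

Let cons_measure_semi_sigma_additive : semi_sigma_additive cons_measure.
Proof.
have mpre A : measurable A -> measurable (pair_cons @^-1` A).
  by move=> mA; rewrite -[X in measurable X]setTI; exact: measurable_pair_cons.
move=> F mF tF mUF; rewrite /cons_measure /pushforward preimage_bigcup.
apply: measure_semi_sigma_additive.
- by move=> i; exact: mpre.
- apply/trivIsetP => /= i j _ _ ij; rewrite -preimage_setI.
  by move/trivIsetP : tF => /(_ _ _ _ _ ij) ->//; rewrite preimage_set0.
- by rewrite -preimage_bigcup; exact: mpre.
Qed.

HB.instance Definition _ := isMeasure.Build _ _ _ cons_measure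
  cons_measure0 cons_measure_ge0 cons_measure_semi_sigma_additive.

Let cons_measure_sigma_finite : sigma_finite setT cons_measure.
Proof.
have /sigma_finiteP[F [TF ndF Foo]] := sigma_finiteT mu.
have /sigma_finiteP[G [TG ndG Goo]] := sigma_finiteT nu.
exists (fun i => tuple_uncons @^-1` (F i `*` G i)).
  rewrite predeqE => t; split=> // _.
  have [i _ Fi] : (\bigcup_i F i) (thead t) by rewrite -TF.
  have [j _ Gj] : (\bigcup_j G j) [tuple of behead t] by rewrite -TG.
  exists (maxn i j) => //; split.
  - by move: Fi; exact/subsetPset/ndF/leq_maxl.
  - by move: Gj; exact/subsetPset/ndG/leq_maxr.
move=> i; have [mF Fioo] := Foo i; have [mG Gioo] := Goo i; split.
  rewrite -[X in measurable X]setTI.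
  by apply: measurable_tuple_uncons => //; exact: measurableX.
rewrite /cons_measure /pushforward -comp_preimage.
have -> : tuple_uncons \o pair_cons = id by apply/funext; exact: pair_consK.
by rewrite product_measure1E// lte_mul_pinfty// ge0_fin_numE.
Qed.

HB.instance Definition _ := @Measure_isSigmaFinite.Build _ _ _ cons_measure
  cons_measure_sigma_finite.

End cons_measure.

Fixpoint tuple_measure k : {sigma_finite_measure set (k.-tuple T) -> \bar R} :=
  match k with
  | 0 => [the {sigma_finite_measure set _ -> \bar R} of \d_[tuple]]
  | k'.+1 => [the {sigma_finite_measure set _ -> \bar R} of
               cons_measure (tuple_measure k')]
  end.

Lemma tuple_measure_box k (A : 'I_k -> set T) :
  (forall i, measurable (A i)) ->
  tuple_measure k [set t | forall i, A i (tnth t i)] = (\prod_(i < k) mu (A i))%E.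
Proof.
elim: k A => [|k IH] A mA /=.
  by rewrite big_ord0 diracE mem_set//= => -[].
rewrite big_ord_recl -IH//.
have mB : measurable [set t : k.-tuple T | forall i, A (lift ord0 i) (tnth t i)].
  rewrite (_ : mkset _ = \bigcap_i ((@tnth _ T)^~ i @^-1` A (lift ord0 i))).
    apply: fin_bigcap_measurable => // i _.
    by rewrite -[X in measurable X]setTI; exact: measurable_tnth.
  by apply/seteqP; split => t /= + i; [move=> + _|]; apply.
rewrite -product_measure1E// /cons_measure /pushforward; congr (_ _).
apply/seteqP; split => -[x t] /=.
  move=> H; split; first by have := H ord0; rewrite tnth0.
  by move=> i; have := H (lift ord0 i); rewrite tnthS.
move=> [H0 HS] i; case: (unliftP ord0 i) => [j ->|->]; first by rewrite tnthS.
by rewrite tnth0.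
Qed.

End tuple_measure.

(* Measurability with respect to the completion of mu (Lebesgue measurability,
   when mu is the Borel-Lebesgue measure).  The integral [\int[mu]] of the
   library is defined for all functions, through lower integrals of the
   positive and negative parts; by [ae_eq_integral_any] below, on an
   [ae_measurable] function it agrees with the integral of any measurable
   representative. *)
Section ae_measurable.
Context {d : measure_display} {T : measurableType d} {R : realType}.
Variable mu : {measure set T -> \bar R}.

Definition ae_measurable (f : T -> R) :=
  exists2 g : T -> R, measurable_fun [set: T] g & ae_eq mu [set: T] f g.

Definition ae_integrable (f : T -> R) :=
  ae_measurable f /\ (\int[mu]_x `|f x|%:E < +oo)%E.

Definition Lp_space (p : \bar R) (f : T -> R) :=
  ae_measurable f /\ ('N[mu]_p[EFin \o f] < +oo)%E.

Import HBNNSimple.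

Let ge0_ae_le_integral (f g : T -> \bar R) : (forall x, (0 <= f x)%E) ->
  (forall x, (0 <= g x)%E) -> ae_eq mu [set: T] f g ->
  (\int[mu]_x f x <= \int[mu]_x g x)%E.
Proof.
move=> f0 g0 [N [mN N0 fgN]]; rewrite !ge0_integralTE//.
apply/ge_ereal_sup => _ [h /= hf <-].
pose k := proj_nnsfun h (measurableC mN).
have kE x : k x = (h \_ (~` N)) x by rewrite (mrestrict h (measurableC mN)).
apply: le_trans (_ : (sintegral mu k <= _)%E); last first.
  apply: ereal_sup_ubound; exists k => // x; rewrite kE patchE.
  have [xN|//] := boolP (x \in ~` N).
  rewrite (le_trans (hf x))// (_ : f x = g x)//.
  by apply: contrapT => fgx; move: xN; rewrite inE; apply; apply: fgN => /= /(_ I).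
have toint (u : {nnsfun T >-> R}) : sintegral mu u = (\int[mu]_x (u x)%:E)%E.
  by rewrite integral_nnsfun// patch_setT.
rewrite !toint le_eqVlt; apply/orP; left; apply/eqP.
apply: ae_eq_integral => //.
- by apply/measurable_EFinP; exact: measurable_funPT.
- by apply/measurable_EFinP; exact: measurable_funPT.
exists N; split => // x hk; apply: contrapT => xN; apply: hk => _.
by change ((h x)%:E = (k x)%:E); rewrite kE patchE (_ : x \in ~` N)// inE.
Qed.

Lemma ae_eq_integral_any (f g : T -> \bar R) : ae_eq mu [set: T] f g ->
  (\int[mu]_x f x = \int[mu]_x g x)%E.
Proof.
have le0 (a b : T -> \bar R) : (forall x, 0 <= a x)%E ->
    (forall x, 0 <= b x)%E -> ae_eq mu [set: T] a b ->
    (\int[mu]_x a x = \int[mu]_x b x)%E.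
  move=> a0 b0 ab; apply/eqP; rewrite eq_le !ge0_ae_le_integral//.
  exact: ae_eq_sym.
move=> /ae_eq_funeposneg[fgp fgn]; rewrite integralE [RHS]integralE.
by congr (_ - _)%E; apply: le0 => //.
Qed.

Lemma ae_eq_Rintegral (f g : T -> R) : ae_eq mu [set: T] f g ->
  \int[mu]_x f x = \int[mu]_x g x.
Proof.
move=> fg; rewrite /Rintegral; congr fine; apply: ae_eq_integral_any.
exact: (ae_eq_comp EFin fg).
Qed.

Lemma ae_integrableP (f : T -> R) : ae_integrable f <->
  exists2 g : T -> R, mu.-integrable [set: T] (EFin \o g) &
    ae_eq mu [set: T] f g.
Proof.
have nE (g : T -> R) : ae_eq mu [set: T] f g ->
    (\int[mu]_x `|f x|%:E = \int[mu]_x `|(g x)%:E|)%E.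
  move=> fg; apply: ae_eq_integral_any.
  exact: (ae_eq_comp (fun r : R => `|r|%:E) fg).
split=> [[[g mg fg] foo]|[g ig fg]].
  exists g => //; apply/integrableP; split; first exact/measurable_EFinP.
  by rewrite -nE.
move/integrableP : (ig) => [mg goo]; split; last by rewrite (nE g).
by exists g => //; apply/measurable_EFinP.
Qed.

Lemma ae_integrableZl (c : R) (f : T -> R) : ae_integrable f ->
  ae_integrable (fun x => c * f x) /\
  \int[mu]_x (c * f x) = c * \int[mu]_x f x.
Proof.
move=> /ae_integrableP[g ig fg].
have cfg : ae_eq mu [set: T] (fun x => c * f x) (fun x => c * g x).
  exact: (ae_eq_comp (fun r : R => c * r) fg).
split.
  apply/ae_integrableP; exists (fun x => c * g x) => //.
  exact: (integrableZl measurableT c ig).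
by rewrite (ae_eq_Rintegral cfg) (ae_eq_Rintegral fg) RintegralZl.
Qed.

Lemma ae_integrableB (f1 f2 : T -> R) : ae_integrable f1 -> ae_integrable f2 ->
  ae_integrable (fun x => f1 x - f2 x) /\
  \int[mu]_x (f1 x - f2 x) = \int[mu]_x f1 x - \int[mu]_x f2 x.
Proof.
move=> /ae_integrableP[g1 ig1 fg1] /ae_integrableP[g2 ig2 fg2].
have fg := ae_eq_sub fg1 fg2.
split.
  apply/ae_integrableP; exists (g1 \- g2) => //.
  exact: (integrableB measurableT ig1 ig2).
by rewrite (ae_eq_Rintegral fg) (ae_eq_Rintegral fg1) (ae_eq_Rintegral fg2) RintegralB.
Qed.

Lemma ae_integrable_sum (I : Type) (s : seq I) (f : I -> T -> R) :
  (forall i, ae_integrable (f i)) ->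
  ae_integrable (fun x => \sum_(i <- s) f i x) /\
  \int[mu]_x (\sum_(i <- s) f i x) = \sum_(i <- s) \int[mu]_x f i x.
Proof.
move=> fI; have z : ae_integrable (fun=> 0).
  apply/ae_integrableP; exists (fun=> 0); last exact: ae_eq_refl.
  exact: (integrable0 mu setT).
elim: s => [|i s [IH1 IH2]].
  under eq_fun do rewrite big_nil; rewrite big_nil; split => //.
  by rewrite /Rintegral integral0.
have [N1 N2] := ae_integrableZl (-1) IH1.
have [D1 D2] := ae_integrableB (fI i) N1.
have E : (fun x => \sum_(j <- i :: s) f j x) =
    (fun x => f i x - -1 * \sum_(j <- s) f j x).
  by apply/funext => x; rewrite big_cons mulN1r opprK.
rewrite E; split=> //.
by rewrite big_cons -IH2 D2 N2 mulN1r opprK.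
Qed.

End ae_measurable.

Notation Rn R n := (n.-tuple (measurableTypeR R)).

Section euclidean_space.
Context {R : realType} {n : nat}.
Implicit Types (x y : Rn R n) (g w v b : Rn R n -> R).

Definition lebn : {sigma_finite_measure set (Rn R n) -> \bar R} :=
  tuple_measure (@lebesgue_measure R) n.

Definition edist x y : R := Num.sqrt (\sum_(i < n) (tnth x i - tnth y i) ^+ 2).

Definition eball x (r : R) : set (Rn R n) := [set y | edist x y < r].

Definition bvol x (r : R) : R := fine (lebn (eball x r)).

Definition baverage g x (r : R) : R :=
  (bvol x r)^-1 * \int[lebn]_(y in eball x r) g y.

Definition locally_integrable_n g :=
  ae_measurable lebn g /\
  forall x (r : R), 0 < r -> (\int[lebn]_(y in eball x r) `|g y|%:E < +oo)%E.

Definition weight w :=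
  locally_integrable_n w /\ {ae lebn, forall x, 0 < w x}.

Definition Lipschitz_space (dl : R) b :=
  exists C : R, forall x y, `|b x - b y| <= C * edist x y `^ dl.

Definition reverse_holder (s : R) w :=
  weight w /\ exists C : R, forall x (r : R), 0 < r ->
    (((bvol x r)^-1%:E * \int[lebn]_(y in eball x r) (w y `^ s)%:E) `^ s^-1
      <= C%:E * ((bvol x r)^-1%:E * \int[lebn]_(y in eball x r) (w y)%:E))%E.

(* The measure of the ball B(x, r) with density w^-1. *)
Definition inv_weight_ball w x (r : R) : R :=
  \int[lebn]_(y in eball x r) (w y)^-1.

Definition wlip_oscillation w (dt : R) g x (r : R) : \bar R :=
  ((inv_weight_ball w x r * bvol x r `^ (dt / n%:R))^-1%:E *
   \int[lebn]_(y in eball x r) `|g y - baverage g x r|%:E)%E.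

Definition weighted_Lipschitz_space w (dt : R) g :=
  locally_integrable_n g /\
  exists M : R, forall x (r : R), 0 < r -> (wlip_oscillation w dt g x r <= M%:E)%E.

Definition weight_class_H (m : nat) (dl : R) (p : 'I_m -> \bar R) (be dt : R)
    w (v : 'I_m -> Rn R n -> R) :=
  locally_integrable_n (fun x => (w x)^-1) /\
  exists be_ : 'I_m -> R,
    [/\ forall i, 0 < be_ i < n%:R, \sum_(i < m) be_ i = be &
      exists2 C : R, 0 < C & forall x (r : R), 0 < r ->
        ((bvol x r `^ (1 + (dl - dt) / n%:R) / inv_weight_ball w x r)%:E *
         \prod_(i < m) 'N[lebn]_(hoelder_conjugate (p i))
           [EFin \o (fun y => (v i y)^-1 /
             (bvol x r `^ n%:R^-1 + edist x y) `^ (n%:R - be_ i + dl / m%:R))%R]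
         <= C%:E)%E].

End euclidean_space.

Section multilinear_operators.
Context {R : realType} {n m : nat}.
Implicit Types (x : Rn R n) (y : m.-tuple (Rn R n)).
Implicit Types (K : Rn R n -> m.-tuple (Rn R n) -> R).
Implicit Types (b f : 'I_m -> Rn R n -> R).

Definition lebmn : {sigma_finite_measure set (m.-tuple (Rn R n)) -> \bar R} :=
  tuple_measure (@lebn R n) m.

Definition dist_sum x y : R := \sum_(i < m) edist x (tnth y i).

Definition kernel_measurable K :=
  ae_measurable (@lebn R n \x lebmn)%E (fun z => K z.1 z.2).

(* Nothing is required at y = (x, .., x), where the bound is infinite. *)
Definition kernel_size (al : R) K :=
  exists C : R, forall x y, 0 < dist_sum x y ->
    `|K x y| <= C * dist_sum x y `^ (- ((m * n)%:R - al)).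

Definition kernel_smooth (al ga : R) K :=
  exists C c : R, [/\ 0 < C, 0 < c &
    forall x x' y, c * edist x x' < dist_sum x y ->
      `|K x y - K x' y| <=
        C * (edist x x' `^ ga / dist_sum x y `^ ((m * n)%:R - al + ga))].

Definition tprod f y : R := \prod_(i < m) f i (tnth y i).

Definition multilinear_op K f x : R := \int[lebmn]_y (K x y * tprod f y).

Definition mul_at (j : 'I_m) b f : 'I_m -> Rn R n -> R :=
  fun i => if i == j then (fun u => b j u * f j u) else f i.

Definition commutator K b f x : R :=
  \sum_(j < m) (b j x * multilinear_op K f x - multilinear_op K (mul_at j b f) x).

Definition commutator_kernel K b x y : R :=
  \sum_(j < m) (b j x - b j (tnth y j)) * K x y.

(* For f_i v_i in L^{p_i} with p > n / (alpha + delta) the integrals defining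
   the commutator at a point x may diverge at infinity, for almost every x
   simultaneously; only the differences of two values of the commutator are
   given by convergent integrals.  So the commutator is in general a function
   defined modulo an additive constant, as usual for operators with values in
   a space of Lipschitz type: [is_commutator K b f F] says that F is a
   representative.  When the integrals do converge, the pointwise formulas are
   representatives: see [commutator_integral_is_commutator] and
   [commutator_is_commutator]. *)
Definition is_commutator K b f (F : Rn R n -> R) :=
  {ae lebn, forall x, {ae lebn, forall x',
    let D y :=
      (commutator_kernel K b x y - commutator_kernel K b x' y) * tprod f y in
    ae_integrable lebmn D /\ F x - F x' = \int[lebmn]_y D y}}.

Lemma commutator_integral_is_commutator K b f :
  {ae lebn, forall x,
    ae_integrable lebmn (fun y => commutator_kernel K b x y * tprod f y)} ->
  is_commutator K b f
    (fun x => \int[lebmn]_y (commutator_kernel K b x y * tprod f y)).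
Proof.
move=> Kf; apply: filterS (Kf) => x Kx; apply: filterS Kf => x' Kx' /=.
have [I E] := ae_integrableB Kx Kx'.
have DE : (fun y => (commutator_kernel K b x y - commutator_kernel K b x' y) *
    tprod f y) = (fun y => commutator_kernel K b x y * tprod f y -
                           commutator_kernel K b x' y * tprod f y).
  by apply/funext => y; rewrite mulrBl.
by rewrite /= DE.
Qed.

Lemma tprod_mul_at j b f y :
  tprod (mul_at j b f) y = b j (tnth y j) * tprod f y.
Proof.
rewrite /tprod (bigD1 j)//= [in RHS](bigD1 j)//= /mul_at eqxx mulrA.
by congr (_ * _); apply: eq_bigr => i /negbTE ->.
Qed.

Lemma commutator_is_commutator K b f :
  {ae lebn, forall x, ae_integrable lebmn (fun y => K x y * tprod f y) /\
    forall j, ae_integrable lebmn (fun y => K x y * tprod (mul_at j b f) y)} ->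
  is_commutator K b f (commutator K b f).
Proof.
move=> Kf.
have H : {ae lebn, forall x,
    ae_integrable lebmn (fun y => commutator_kernel K b x y * tprod f y) /\
    commutator K b f x =
      \int[lebmn]_y (commutator_kernel K b x y * tprod f y)}.
  apply: filterS Kf => x [K0 Kj].
  have Ij j := ae_integrableB (ae_integrableZl (b j x) K0).1 (Kj j).
  have [S1 S2] := ae_integrable_sum (index_enum 'I_m) (fun j => (Ij j).1).
  have E : (fun y => commutator_kernel K b x y * tprod f y) = (fun y =>
      \sum_(j < m) (b j x * (K x y * tprod f y) - K x y * tprod (mul_at j b f) y)).
    apply/funext => y; rewrite /commutator_kernel mulr_suml.
    by apply: eq_bigr => j _; rewrite tprod_mul_at; ring.
  rewrite E; split => //; rewrite S2; apply: eq_bigr => j _.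
  by rewrite (Ij j).2 (ae_integrableZl (b j x) K0).2.
have C : is_commutator K b f
    (fun x => \int[lebmn]_y (commutator_kernel K b x y * tprod f y)).
  by apply: commutator_integral_is_commutator; apply: filterS H => x [].
apply: filterS2 (H) C => x [_ Ex] Cx; apply: filterS2 H Cx => x' [_ Ex'] /= [? <-].
by rewrite Ex Ex'.
Qed.

End multilinear_operators.

(* Main.v *)
Require Import Defs.
From mathcomp Require Import all_boot all_order all_algebra.
From mathcomp Require Import all_classical all_reals all_analysis.
From mathcomp Require Import measurable_realfun ess_sup_inf.
From mathcomp Require Import ring lra.
Import Order.TTheory GRing.Theory Num.Theory.
Import numFieldNormedType.Exports.
Import Defs.
Local Open Scope classical_set_scope.
Local Open Scope ring_scope.
Set Implicit Arguments.
Unset Strict Implicit.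
Unset Printing Implicit Defensive.

(** The proof compares two values of the commutator on a ball [B = B(z, r)] and
    integrates.  For [x, x'] in [B] the difference [F x - F x'] is the integral
    over [y] of

      [\sum_j ((b_j x - b_j y_j) K x y - (b_j x' - b_j y_j) K x' y)]

    against [\prod_i f_i (y_i)].

    Far from [B], where [\sum_i |z - y_i| >= M r], the difference is rewritten
    with [b_j x - b_j x'] and [K x y - K x' y].  The Lipschitz condition, the
    size and the smoothness of the kernel (with [dl < ga]) bound it by
    [r ^ dl (\sum_i |z - y_i|) ^ (- (m n - al))], which splits into the product
    of the powers [(r + |z - y_i|) ^ (- (n - be_i + dl / m))].  After Hoelder's
    inequality the norms of the class [weight_class_H] appear.

    Near [B] the two terms are estimated separately by the size condition.  Each
    is at most a constant times [\prod_i |x - y_i| ^ (- th_i)], where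
    [\sum_i th_i = m n - (al + dl)] ([commutator_kernel_le]).  The exponents are
    [th_i = sg (1 - 1/p_i + 1/(m p_i))] with one [sg] for all [i]; the condition
    [p > n / (al + dl)] says exactly enough to have [sg < n]
    ([local_exponent]).  The reverse Hoelder condition puts [v_i ^ (- p_i')] in
    [L^m] of the ball.  A normalized Young inequality ([ae_young]) bounds each
    factor [|f_i| k ^ (th_i / sg)], where [k] is the kernel of exponent [sg], by
    an [L^1] density times [k ^ (1 / m)] plus an [L^m] density times [k].  By
    Jensen's inequality the product of the [m] resulting integrals is at most
    one linear potential [W x] with kernel [k] ([prod_integral_le]); since
    [sg < n], the integral of [W] over the ball is controlled
    ([local_dominant]).

    Together, [|F x - F x'| <= A (1 + W x + W x')] for almost every [x, x'] in
    [B] ([commutator_difference_le]), and averaging gives the bound of the mean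
    oscillation ([oscillation_le]).  Applied to an exhausting sequence of balls,
    the same estimate shows that the integrals defining [F x - F x'] converge
    for almost every [x, x'], so that [x |-> \int D(x, x0, y) dy], with a fixed
    generic [x0], is a representative of the commutator
    ([is_commutator_exists]). *)

(** * Integrals of nonnegative functions and products of measures *)

Section general_measure.
Context {d : measure_display} {T : measurableType d} {R : realType}.
Variable mu : {measure set T -> \bar R}.

(** Monotonicity of the integral of nonnegative functions needs no
    measurability, the integral being a supremum over simple functions. *)
Lemma ge0_le_integral_any (D : set T) (f g : T -> \bar R) :
  (forall x, D x -> (0 <= f x)%E) -> (forall x, D x -> (f x <= g x)%E) ->
  (\int[mu]_(x in D) f x <= \int[mu]_(x in D) g x)%E.
Proof.
move=> f0 fg; rewrite (integral_mkcond D f) (integral_mkcond D g).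
have g0 x : D x -> (0 <= g x)%E by move=> Dx; apply: le_trans (fg _ Dx); exact: f0.
rewrite !ge0_integralTE; last 2 first.
- by move=> x; exact: erestrict_ge0.
- by move=> x; exact: erestrict_ge0.
apply/ge_ereal_sup => _ [h /= hf <-].
apply: ereal_sup_ubound; exists h => //= x; apply: le_trans (hf x) _.
by rewrite !patchE; case: ifPn => // /[!inE] /fg.
Qed.

Lemma ae_ge0_le_integral_any (D : set T) (f g : T -> \bar R) :
  (forall x, D x -> (0 <= f x)%E) -> (forall x, D x -> (0 <= g x)%E) ->
  {ae mu, forall x, D x -> (f x <= g x)%E} ->
  (\int[mu]_(x in D) f x <= \int[mu]_(x in D) g x)%E.
Proof.
move=> f0 g0 fg; rewrite (integral_mkcond D f) (integral_mkcond D g).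
have -> : (\int[mu]_x (f \_ D) x =
           \int[mu]_x (Order.min ((f \_ D) x) ((g \_ D) x)))%E.
  apply: ae_eq_integral_any; apply: filterS fg => x fg _; apply/esym/min_idPl.
  by rewrite !patchE; case: ifPn => // /[!inE] /fg.
apply: ge0_le_integral_any => x _; last by rewrite ge_min lexx orbT.
by rewrite le_min !erestrict_ge0.
Qed.

(** The power [h ^ m.+1] lies above its tangent line at [l]. *)
Lemma pow_tangent (m : nat) (l h : R) : 0 <= l -> 0 <= h ->
  m.+1%:R * l ^+ m * h <= h ^+ m.+1 + m%:R * l ^+ m.+1.
Proof.
move=> l0 h0; elim: m => [|m IH].
  by rewrite expr0 expr1 mul0r addr0 !mul1r.
have D : 0 <= (h - l) * (h ^+ m.+1 - l ^+ m.+1).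
  case: (leP l h) => lh.
    by rewrite mulr_ge0// subr_ge0// lerXn2r.
  by rewrite mulr_le0// subr_le0 ?lerXn2r//; exact: ltW.
have := ler_wpM2l l0 IH.
move: D; rewrite !exprS -!natr1.
set a := h ^+ m; set c := l ^+ m; set q := (m%:R : R); nra.
Qed.

(** Jensen's inequality for the power [m] and a sub-probability density [a]: the
    tangent-line inequality at [l = \int a h] is integrated against [a]. *)
Lemma pow_integral_le (m : nat) (a h : T -> R) : (0 < m)%N ->
  (forall x, 0 <= a x) -> (forall x, 0 <= h x) ->
  measurable_fun [set: T] a -> measurable_fun [set: T] h ->
  (\int[mu]_x (a x)%:E <= 1)%E ->
  ((\int[mu]_x (a x * h x)%:E) ^+ m <= \int[mu]_x (a x * h x ^+ m)%:E)%E.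
Proof.
case: m => // m _ a0 h0 ma mh a1.
have mah k : measurable_fun [set: T] (fun x => a x * h x ^+ k).
  by apply: measurable_funM => //; exact: measurable_funX.
have key (l : R) : 0 <= l -> ((m.+1%:R * l ^+ m)%:E * \int[mu]_x (a x * h x)%:E <=
    \int[mu]_x (a x * h x ^+ m.+1)%:E + (m%:R * l ^+ m.+1)%:E)%E.
  move=> l0.
  rewrite -ge0_integralZl_EFin//; last 3 first.
  - by move=> x _; rewrite lee_fin mulr_ge0.
  - by apply/measurable_EFinP; exact: (mah 1%N).
  - by rewrite mulr_ge0// exprn_ge0.
  apply: (@le_trans _ _ (\int[mu]_x (a x * h x ^+ m.+1)%:E +
     (m%:R * l ^+ m.+1)%:E * \int[mu]_x (a x)%:E)%E); last first.
    rewrite leeD2l// -[leRHS]mule1 lee_pmul//.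
    - by rewrite lee_fin mulr_ge0// exprn_ge0.
    - by apply: integral_ge0 => x _; rewrite lee_fin.
  rewrite -ge0_integralZl_EFin//; last 3 first.
  - by move=> x _; rewrite lee_fin.
  - exact/measurable_EFinP.
  - by rewrite mulr_ge0// exprn_ge0.
  rewrite -ge0_integralD//; last 4 first.
  - by move=> x _; rewrite lee_fin mulr_ge0// exprn_ge0.
  - by apply/measurable_EFinP.
  - by move=> x _; rewrite -EFinM lee_fin !mulr_ge0// exprn_ge0.
  - by apply/measurable_EFinP; exact: measurable_funM.
  apply: ge0_le_integral_any => x _; first by rewrite lee_fin !mulr_ge0// exprn_ge0.
  rewrite -!EFinM -EFinD lee_fin.
  have := ler_wpM2l (a0 x) (pow_tangent m l0 (h0 x)).
  have -> : a x * (m.+1%:R * l ^+ m * h x) = m.+1%:R * l ^+ m * (a x * h x) by ring.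
  by rewrite mulrDr [a x * (m%:R * _)]mulrC.
set J := (\int[mu]_x (a x * h x ^+ m.+1)%:E)%E in key *.
have J0 : (0 <= J)%E by apply: integral_ge0 => x _; rewrite lee_fin mulr_ge0// exprn_ge0.
clearbody J.
have : (0 <= \int[mu]_x (a x * h x)%:E)%E.
  by apply: integral_ge0 => x _; rewrite lee_fin mulr_ge0.
case E : (\int[mu]_x (a x * h x)%:E)%E => [l| |]//.
- rewrite lee_fin => l0; have := key _ l0; rewrite E -EFinM.
  case: J J0 {key} => [j| |]//; last by rewrite !leey.
  move=> _; rewrite -EFinD lee_fin -EFin_expe lee_fin => H.
  move: H; rewrite !exprS -natr1; set u := l ^+ m; nra.
- move=> _; have := key 1 ler01; rewrite E expr1n mulr1 gt0_muley ?lte_fin ?ltr0n//.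
  by case: J J0 {key} => [j _|_|]//=; rewrite ?leey// leye_eq.
Qed.

End general_measure.

(** Almost every slice of a set of full measure has full measure. *)
Lemma ae_xsection d1 d2 (T1 : measurableType d1) (T2 : measurableType d2)
    (R : realType) (m1 : {sigma_finite_measure set T1 -> \bar R})
    (m2 : {sigma_finite_measure set T2 -> \bar R}) (P : T1 * T2 -> Prop) :
  {ae (m1 \x m2)%E, forall z, P z} ->
  {ae m1, forall x, {ae m2, forall y, P (x, y)}}.
Proof.
move=> [N [mN N0 PN]].
have f0 (z : T1 * T2) : (0 <= (\1_N z : R)%:E)%E by rewrite lee_fin.
have mf : measurable_fun [set: T1 * T2] (fun z => (\1_N z : R)%:E).
  exact/measurable_EFinP.
have iN0 : (\int[m1 \x m2]_z (\1_N z : R)%:E = 0)%E.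
  by rewrite integral_indic// setIT.
have := @fubini_tonelli1 _ _ T1 T2 R m1 m2 _ mf f0.
rewrite iN0 => /esym I0.
have mF := @measurable_fun_fubini_tonelli_F _ _ T1 T2 R m2 _ mf f0.
have F0 x : (0 <= fubini_F m2 (fun z => (\1_N z : R)%:E) x)%E.
  by apply: integral_ge0 => y _; rewrite lee_fin.
have : ae_eq m1 [set: T1] (fubini_F m2 (fun z => (\1_N z : R)%:E)) (cst 0%E).
  apply/ae_eq_integral_abs => //.
  by rewrite -I0; apply: eq_integral => x _; rewrite gee0_abs.
apply: filterS => x /(_ I) Fx.
exists (xsection N x); split.
- exact: measurable_xsection.
- have := indic_fubini_tonelli_FE m2 mN => /(congr1 (fun g => g x)) /= <-.
  exact: Fx.
- by move=> y /= nP; rewrite /xsection/= inE; apply: PN.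
Qed.

Section tensor.
Context {d : measure_display} {T : measurableType d} {R : realType}.
Variable mu : {sigma_finite_measure set T -> \bar R}.

Lemma measurable_tprod_gen k (h : 'I_k -> T -> R) :
  (forall i, measurable_fun [set: T] (h i)) ->
  measurable_fun [set: k.-tuple T] (fun t => \prod_(i < k) h i (tnth t i)).
Proof.
move=> mh; apply: measurable_prod => i _.
exact: (measurableT_comp (mh i) (measurable_tnth i)).
Qed.

(** The integral of a tensor product of nonnegative functions. *)
Lemma tuple_measure_tensor k (h : 'I_k -> T -> R) :
  (forall i, measurable_fun [set: T] (h i)) -> (forall i x, 0 <= h i x) ->
  (\int[tuple_measure mu k]_t (\prod_(i < k) h i (tnth t i))%:E =
   \prod_(i < k) \int[mu]_x (h i x)%:E)%E.
Proof.
elim: k h => [|k IH] h mh h0.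
  rewrite big_ord0 /= integral_dirac//; last first.
    by apply/measurable_EFinP; exact: measurable_tprod_gen.
  by rewrite big_ord0 diracT mul1e.
rewrite big_ord_recl -IH//.
have mt : measurable_fun [set: k.+1.-tuple T]
    (fun t => (\prod_(i < k.+1) h i (tnth t i))%:E).
  by apply/measurable_EFinP; exact: measurable_tprod_gen.
have p0 (t : k.+1.-tuple T) : (0 <= (\prod_(i < k.+1) h i (tnth t i))%:E)%E.
  by rewrite lee_fin prodr_ge0.
rewrite /= /cons_measure ge0_integral_pushforward//; last first.
  exact: measurable_pair_cons.
rewrite preimage_setT fubini_tonelli1; last 2 first.
- exact: measurableT_comp mt (@measurable_pair_cons _ _ _).
- by move=> x; exact: p0.
have I0 : (0 <= \int[tuple_measure mu k]_t
    (\prod_(i < k) h (lift ord0 i) (tnth t i))%:E)%E.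
  by apply: integral_ge0 => t _; rewrite lee_fin prodr_ge0.
transitivity (\int[mu]_x ((h ord0 x)%:E * \int[tuple_measure mu k]_t
    (\prod_(i < k) h (lift ord0 i) (tnth t i))%:E))%E.
  apply: eq_integral => x _; rewrite /fubini_F.
  rewrite -ge0_integralZl_EFin//; last 2 first.
  - by move=> t _; rewrite lee_fin prodr_ge0.
  - apply/measurable_EFinP; exact: (@measurable_tprod_gen k (fun i => h (lift ord0 i))).
  apply: eq_integral => t _ /=; rewrite big_ord_recl EFinM tnth0.
  by congr (_ * (_)%:E)%E; apply: eq_bigr => i _; rewrite tnthS.
rewrite ge0_integralZr//; last 2 first.
- exact/measurable_EFinP.
- by move=> x _; rewrite lee_fin.
Qed.

Lemma ae_tnth k (i : 'I_k) (P : T -> Prop) : {ae mu, forall x, P x} ->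
  {ae tuple_measure mu k, forall t, P (tnth t i)}.
Proof.
move=> [N [mN N0 PN]].
exists [set t | forall j, (if j == i then N else setT) (tnth t j)]; split.
- rewrite (_ : mkset _ = (@tnth _ _)^~ i @^-1` N).
    by rewrite -[X in measurable X]setTI; exact: measurable_tnth.
  apply/seteqP; split => t /=; first by move=> /(_ i); rewrite eqxx.
  by move=> Nt j; case: eqP => // ->.
- rewrite (@tuple_measure_box _ _ _ mu k (fun j => if j == i then N else setT)); last first.
    by move=> j; case: ifP.
  by rewrite (bigD1 i)//= eqxx N0 mul0e.
- by move=> t /= nP j; case: eqP => // ->; exact: PN.
Qed.

End tensor.

(** * Euclidean distance, balls and Hoelder continuous functions *)

Section euclidean_distance.
Context {R : realType} {n : nat}.
Implicit Types (x y z : Rn R n) (r : R).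

Lemma eudist_ge0 x y : 0 <= edist x y.
Proof. exact: sqrtr_ge0. Qed.

Lemma eudistC x y : edist x y = edist y x.
Proof.
by rewrite /edist; congr Num.sqrt; apply: eq_bigr => i _; rewrite -sqrrN opprB.
Qed.

Lemma eudist_triangle y x z : edist x z <= edist x y + edist y z.
Proof.
rewrite /edist; pose a i := tnth x i - tnth y i; pose c i := tnth y i - tnth z i.
rewrite (eq_bigr (fun i => (a i + c i) ^+ 2)); last first.
  by move=> i _; rewrite /a /c addrA subrK.
rewrite -[X in _ <= Num.sqrt X + _]/(\sum_(i < n) a i ^+ 2).
rewrite -[X in _ <= _ + Num.sqrt X]/(\sum_(i < n) c i ^+ 2).
set A := \sum_(i < n) a i ^+ 2; set B := \sum_(i < n) c i ^+ 2.
have A0 : 0 <= A by apply: sumr_ge0 => i _; exact: sqr_ge0.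
have B0 : 0 <= B by apply: sumr_ge0 => i _; exact: sqr_ge0.
set s := Num.sqrt A; set t := Num.sqrt B.
have s0 : 0 <= s := sqrtr_ge0 _; have t0 : 0 <= t := sqrtr_ge0 _.
have sA : s ^+ 2 = A by exact: sqr_sqrtr.
have tB : t ^+ 2 = B by exact: sqr_sqrtr.
have sumsq (l u : R) : \sum_i (l * a i + u * c i) ^+ 2 =
    l ^+ 2 * A + 2 * l * u * (\sum_i a i * c i) + u ^+ 2 * B.
  rewrite /A /B !mulr_sumr -!big_split/=; apply: eq_bigr => i _; rewrite /a /c; ring.
have CS : \sum_i a i * c i <= s * t.
  have [st0|st0] := eqVneq (s * t) 0; last first.
    have : 0 <= \sum_i (t * a i + (- s) * c i) ^+ 2.
      by apply: sumr_ge0 => i _; exact: sqr_ge0.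
    rewrite sumsq -sA -tB => H.
    have st : 0 < s * t by rewrite lt_def st0 mulr_ge0.
    rewrite -(ler_pM2l st); nra.
  suff -> : \sum_i a i * c i = 0 by rewrite st0.
  apply: big1 => i _; move/eqP : st0; rewrite mulf_eq0 => /orP[|] /eqP z0.
  - have /psumr_eq0P H : A = 0 by rewrite -sA z0 expr0n.
    have := H (fun i _ => sqr_ge0 _) i isT => /eqP; rewrite sqrf_eq0 => /eqP.
    by rewrite -/(a i) => ->; rewrite mul0r.
  - have /psumr_eq0P H : B = 0 by rewrite -tB z0 expr0n.
    have := H (fun i _ => sqr_ge0 _) i isT => /eqP; rewrite sqrf_eq0 => /eqP.
    by rewrite -/(c i) => ->; rewrite mulr0.
rewrite -[leRHS]ger0_norm ?addr_ge0// -sqrtr_sqr ler_sqrt ?sqr_ge0//.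
rewrite (eq_bigr (fun i => (1 * a i + 1 * c i) ^+ 2)); last first.
  by move=> i _; rewrite !mul1r.
rewrite sumsq sqrrD sA tB; nra.
Qed.

Lemma eudist_coord_le x y i : `|tnth x i - tnth y i| <= edist x y.
Proof.
rewrite -sqrtr_sqr /edist ler_sqrt; last by apply: sumr_ge0 => j _; exact: sqr_ge0.
by rewrite (bigD1 i)//= lerDl; apply: sumr_ge0 => j _; exact: sqr_ge0.
Qed.

(** A cube of half-side [r / n.+1] is contained in the ball of radius [r]; the
    denominator [n.+1] makes the inequality strict and covers [n = 0]. *)
Lemma eudist_lt x y r : 0 < r ->
  (forall i, `|tnth x i - tnth y i| <= r / n.+1%:R) -> edist x y < r.
Proof.
move=> r0 H; have -> : r = Num.sqrt (r ^+ 2) by rewrite sqrtr_sqr gtr0_norm.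
rewrite ltr_sqrt ?exprn_gt0//.
apply: (@le_lt_trans _ _ (\sum_(i < n) (r / n.+1%:R) ^+ 2)).
  apply: ler_sum => i _; rewrite -[leLHS]real_normK ?num_real//.
  by rewrite lerXn2r ?nnegrE// divr_ge0// ltW.
rewrite sumr_const card_ord -[_ *+ n]mulr_natr expr_div_n -mulrA gtr_pMr ?exprn_gt0//.
rewrite mulrC ltr_pdivrMr ?exprn_gt0 ?ltr0n// mul1r -natrX ltr_nat.
by rewrite expnS expn1 (leq_trans (ltnSn _))// leq_pmull.
Qed.

Lemma measurable_eudist d (T : measurableType d) (f g : T -> Rn R n) :
  measurable_fun [set: T] f -> measurable_fun [set: T] g ->
  measurable_fun [set: T] (fun t => edist (f t) (g t)).
Proof.
move=> /measurable_fun_tnthP mf /measurable_fun_tnthP mg.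
rewrite (_ : (fun _ => _) = fun t =>
    (\sum_(i < n) (tnth (f t) i - tnth (g t) i) ^+ 2) `^ 2^-1); last first.
  apply/funext => t; rewrite powR12_sqrt//.
  by apply: sumr_ge0 => i _; exact: sqr_ge0.
apply: (measurableT_comp (measurable_powR 2^-1)).
apply: measurable_sum => i; apply: measurable_funX.
by apply: measurable_funB; [exact: mf|exact: mg].
Qed.

Lemma measurable_eball x r : measurable (eball x r).
Proof.
rewrite -[X in measurable X]setTI.
have /(_ measurableT [set true] I) : measurable_fun [set: Rn R n] (fun y => edist x y < r).
  by apply: measurable_fun_ltr => //; exact: measurable_eudist.
by congr measurable; apply/seteqP; split => y /= [].
Qed.

End euclidean_distance.
#[global] Hint Extern 0 (is_true (0 <= edist _ _)) => solve [exact: eudist_ge0] : core.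
#[global] Hint Extern 0 (measurable (eball _ _)) => solve [exact: measurable_eball] : core.

Section ball_volume.
Context {R : realType} {n : nat}.
Implicit Types (x y z : Rn R n) (r : R).
Local Notation leb := (@lebn R n).

Let lebesgue_interval (a : R) r : 0 < r ->
  (@lebesgue_measure R) `]a - r, a + r[%classic = (2 * r)%:E.
Proof.
move=> r0; rewrite lebesgue_measure_itv/= lte_fin ltrBlDr -addrA ltrDl addr_gt0//.
by rewrite -EFinB; congr EFin; ring.
Qed.

Let lebn_box x r : 0 < r ->
  leb [set y | forall i, `](tnth x i) - r, (tnth x i) + r[%classic (tnth y i)] =
    ((2 * r) ^+ n)%:E.
Proof.
move=> r0; rewrite /lebn (@tuple_measure_box _ _ _ (@lebesgue_measure R) n
    (fun i => `](tnth x i) - r, (tnth x i) + r[%classic))//.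
rewrite (eq_bigr (fun=> (2 * r)%:E)); last by move=> i _; exact: lebesgue_interval.
by rewrite prodEFin prodr_const card_ord.
Qed.

Let measurable_box x r : measurable
  [set y : Rn R n | forall i, `](tnth x i) - r, (tnth x i) + r[%classic (tnth y i)].
Proof.
rewrite (_ : mkset _ = \bigcap_i ((@tnth _ _)^~ i @^-1`
    `](tnth x i) - r, (tnth x i) + r[%classic)).
  apply: fin_bigcap_measurable => // i _.
  by rewrite -[X in measurable X]setTI; exact: measurable_tnth.
by apply/seteqP; split => t /= + i; [move=> + _|]; apply.
Qed.

Lemma lebn_eball_le x r : 0 < r -> (leb (eball x r) <= ((2 * r) ^+ n)%:E)%E.
Proof.
move=> r0; rewrite -(lebn_box x r0); apply: le_measure; rewrite ?inE//.
move=> y /= xy i; rewrite in_itv/= ltrBlDr addrC -ltrBlDr.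
have := le_lt_trans (eudist_coord_le x y i) xy; rewrite ltr_norml => /andP[? ?].
by apply/andP; split; lra.
Qed.

Lemma lebn_eball_ge x r : 0 < r ->
  (((2 * (r / n.+1%:R)) ^+ n)%:E <= leb (eball x r))%E.
Proof.
move=> r0; have rn0 : 0 < r / n.+1%:R by rewrite divr_gt0.
rewrite -(lebn_box x rn0); apply: le_measure; rewrite ?inE//.
move=> y /= xy; apply: eudist_lt => // i.
have := xy i; rewrite in_itv/=; set u := r / _ => /andP[? ?].
by rewrite ler_norml; apply/andP; split; lra.
Qed.

Lemma lebn_eball_fin x r : 0 < r -> leb (eball x r) \is a fin_num.
Proof.
move=> r0; rewrite ge0_fin_numE//; apply: le_lt_trans (lebn_eball_le x r0) _.
exact: ltry.
Qed.

Lemma bvolE x r : 0 < r -> (bvol x r)%:E = leb (eball x r).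
Proof. by move=> r0; rewrite /bvol fineK// lebn_eball_fin. Qed.

Lemma bvol_le x r : 0 < r -> bvol x r <= (2 * r) ^+ n.
Proof. by move=> r0; rewrite -lee_fin bvolE//; exact: lebn_eball_le. Qed.

Lemma bvol_ge x r : 0 < r -> (2 * (r / n.+1%:R)) ^+ n <= bvol x r.
Proof. by move=> r0; rewrite -lee_fin bvolE//; exact: lebn_eball_ge. Qed.

Lemma bvol_gt0 x r : 0 < r -> 0 < bvol x r.
Proof.
move=> r0; apply: lt_le_trans (bvol_ge x r0).
by rewrite exprn_gt0// mulr_gt0// divr_gt0.
Qed.

Lemma lebn_setT_gt0 : (0 < leb setT)%E.
Proof.
pose x : Rn R n := [tuple 0 | i < n].
apply: (@lt_le_trans _ _ (leb (eball x 1))).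
  by rewrite -bvolE// lte_fin bvol_gt0.
by apply: le_measure; rewrite ?inE.
Qed.

(** Points are null sets in positive dimension. *)
Lemma ae_neq x : (0 < n)%N -> {ae leb, forall y, 0 < edist x y}.
Proof.
move=> n0.
have mN : measurable [set y | edist x y = 0].
  rewrite (_ : mkset _ = \bigcap_(k in [set: nat]) eball x k.+1%:R^-1).
    by apply: bigcap_measurable => //; exists 0%N.
  apply/seteqP; split => y /=.
    by move=> xy k _; rewrite /eball/= xy invr_gt0.
  move=> H; apply/eqP; rewrite eq_le eudist_ge0 andbT leNgt; apply/negP => xy.
  have [k _ /(_ k (leqnn k))] := near_infty_natSinv_lt (PosNum xy) => /= hk.
  by have := lt_trans (H k I) hk; rewrite ltxx.
exists [set y | edist x y = 0]; split => //.
- apply/eqP; rewrite eq_le measure_ge0 andbT.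
  apply/lee_addgt0Pr => e e0; rewrite add0e.
  have [r r0 rE] : exists2 r : R, 0 < r & (2 * r) ^+ n <= e.
    exists (Num.min 1 e / 2).
      by rewrite divr_gt0// lt_min ltr01.
    rewrite mulrC divfK ?pnatr_eq0//.
    have m0 : 0 <= Num.min 1 e by rewrite le_min ler01 ltW.
    apply: (@le_trans _ _ (Num.min 1 e)); last by rewrite ge_min lexx orbT.
    by rewrite -[leRHS]expr1 ler_wiXn2l// ge_min lexx.
  apply: (@le_trans _ _ (leb (eball x r))).
    apply: le_measure; rewrite ?inE// => y /= xy; by rewrite /eball/= xy.
  by apply: le_trans (lebn_eball_le x r0) _; rewrite lee_fin.
- move=> y /= /negP; rewrite -leNgt => xy.
  by apply/eqP; rewrite eq_le xy eudist_ge0.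
Qed.

End ball_volume.

Section singular_integral.
Context {R : realType} {n : nat}.
Implicit Types (x y z : Rn R n) (r : R).
Local Notation leb := (@lebn R n).

(** Local integrability of a power of the distance, of exponent less than the
    dimension, by summation over dyadic annuli. *)
Lemma integral_eudist_powRN (sg : R) : 0 <= sg < n%:R ->
  exists2 C : R, 0 < C & forall y r, 0 < r ->
    (\int[leb]_(x in eball y r) ((edist y x / r) `^ (- sg))%:E <=
     (C * r ^+ n)%:E)%E.
Proof.
move=> /andP[sg0 sgn].
pose q : R := 2 `^ (sg - n%:R).
have q0 : 0 < q by exact: powR_gt0.
have q1 : q < 1.
  rewrite -(powRr0 2) /q /powR; have -> : (2 == 0 :> R) = false by rewrite pnatr_eq0.
  by rewrite ltr_expR mul0r nmulr_rlt0 ?subr_lt0// ln_gt0// ltr1n.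
exists (2 `^ sg * 2 ^+ n / (1 - q)).
  by rewrite divr_gt0 ?subr_gt0// mulr_gt0// ?powR_gt0// exprn_gt0.
move=> y r r0.
pose rk k : R := r / 2 ^+ k.
have rk0 k : 0 < rk k by rewrite divr_gt0// exprn_gt0.
pose F k x := (2 `^ (sg * k.+1%:R) * \1_(eball y (rk k)) x : R)%:E.
have F0 k x : (0 <= F k x)%E by rewrite lee_fin mulr_ge0// powR_ge0.
have mF k : measurable_fun [set: Rn R n] (F k).
  apply/measurable_EFinP; apply: measurable_funM => //.
apply: (@le_trans _ _ (\int[leb]_x (\sum_(0 <= k <oo) F k x))%E).
  rewrite integral_mkcond; apply: ge0_le_integral_any.
    by move=> x _; apply: erestrict_ge0 => z _; rewrite lee_fin powR_ge0.
  move=> x _; rewrite patchE; case: ifPn => [|_]; last exact: nneseries_ge0.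
  rewrite inE /eball/= => yx.
  have small k : edist y x < rk k -> (edist y x / r) `^ (- sg) <= 2 `^ (sg * k.+1%:R) ->
      (((edist y x / r) `^ (- sg))%:E <= \sum_(0 <= k <oo) F k x)%E.
    move=> yxk le; rewrite (@nneseriesD1 R (fun k => F k x) k xpredT)//.
    apply: (@le_trans _ _ (F k x)).
      by rewrite /F indicE mem_set ?mulr1 ?lee_fin.
    rewrite leeDl//; apply: nneseries_ge0 => *; exact: F0.
  have [yx0|yx0] := eqVneq (edist y x) 0.
    apply: (small 0%N); first by rewrite /rk expr0 divr1.
    rewrite yx0 mul0r; apply: (@le_trans _ _ 1).
      by rewrite /powR eqxx; case: eqP.
    by rewrite mulr1 -[leLHS](powRr0 2) ler_powR// ler1n.
  have {}yx0 : 0 < edist y x by rewrite lt0r yx0 eudist_ge0.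
  have ex : exists k, rk k.+1 <= edist y x.
    have e0 : 0 < edist y x / r by rewrite divr_gt0.
    have [k _ /(_ k (leqnn k))] := near_infty_natSinv_lt (PosNum e0) => /= hk.
    exists k; rewrite /rk mulrC -ler_pdivlMr//.
    apply: le_trans (ltW hk); rewrite lef_pV2 ?posrE ?exprn_gt0// -natrX ler_nat.
    by rewrite (leq_trans (ltn_expl k (ltnSn 1)))// leq_pexp2l.
  have exP : exists k, (rk k.+1 <= edist y x)%R by [].
  case: (ex_minnP exP) => k hk mink.
  apply: (small k).
    case: k hk mink => [|k] hk mink; first by rewrite /rk expr0 divr1.
    rewrite ltNge; apply/negP => /mink; by rewrite ltnn.
  rewrite [sg * _]mulrC powRrM powR_mulrn// [leRHS](_ : _ = (2 ^+ k.+1)^-1 `^ (- sg)); last first.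
    by rewrite -powR_invn// -powRrM mulrNN powRrM powR_mulrn.
  have e0 : (2 ^+ k.+1)^-1 <= edist y x / r by rewrite ler_pdivlMr// mulrC.
  rewrite !powRN lef_pV2 ?posrE ?powR_gt0 ?divr_gt0 ?invr_gt0 ?exprn_gt0//.
  by rewrite ge0_ler_powR ?nnegrE// divr_ge0// ltW.
rewrite integral_nneseries//.
have intF k : (\int[leb]_x F k x <= (2 `^ sg * 2 ^+ n * r ^+ n * q ^+ k)%:E)%E.
  rewrite /F; under eq_integral do rewrite EFinM.
  rewrite ge0_integralZl_EFin ?powR_ge0//; last first.
    exact/measurable_EFinP.
  rewrite integral_indic// setIT.
  apply: le_trans (lee_wpmul2l _ (lebn_eball_le _ (rk0 k))) _.
    by rewrite lee_fin powR_ge0.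
  rewrite -EFinM lee_fin le_eqVlt; apply/orP; left; apply/eqP.
  rewrite -[k.+1%:R]natr1 mulrDr mulr1 powRD; last by rewrite pnatr_eq0/= implybT.
  rewrite /q /rk !exprMn exprVn -exprM.
  have -> : (2 `^ (sg - n%:R)) ^+ k = 2 `^ (sg * k%:R) / 2 ^+ (k * n) :> R.
    rewrite -powR_mulrn ?powR_ge0// -powRrM mulrBl powRB ?pnatr_eq0 ?implybT//.
    by rewrite -natrM powR_mulrn// mulnC.
  ring.
apply: lime_le.
  by apply: is_cvg_nneseries => k _ _; apply: integral_ge0.
apply: nearW => N.
apply: (@le_trans _ _ (\sum_(0 <= k < N) (2 `^ sg * 2 ^+ n * r ^+ n * q ^+ k)%:E)%E).
  exact: lee_sum.
rewrite sumEFin lee_fin.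
have a0 : 0 <= 2 `^ sg * 2 ^+ n * r ^+ n by rewrite !mulr_ge0 ?powR_ge0 ?exprn_ge0// ltW.
have qn : `|q| < 1 by rewrite gtr0_norm.
have := @geometric_le_lim R N _ q a0 q0 qn.
rewrite /series /geometric/= => /le_trans; apply.
by rewrite le_eqVlt; apply/orP; left; apply/eqP; ring.
Qed.

End singular_integral.

Section lipschitz.
Context {R : realType} {n : nat}.

(** A Hoelder continuous function is Borel: its superlevel sets are countable
    unions of balls with rational centers and radii. *)
Lemma Lipschitz_measurable (dl : R) (b : Rn R n -> R) : 0 < dl ->
  Lipschitz_space dl b -> measurable_fun [set: Rn R n] b.
Proof.
move=> dl0 [C0 bC0].
have [C Cpos bC] : exists2 C : R, 0 < C &
    forall x y, `|b x - b y| <= C * edist x y `^ dl.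
  exists (`|C0| + 1); first by rewrite ltr_pwDr.
  move=> x y; apply: le_trans (bC0 x y) _; rewrite ler_wpM2r ?powR_ge0//.
  by rewrite (le_trans (ler_norm _))// lerDl.
move=> mT; apply: (measurability _ (RGenOInfty.measurableE R)) => // _ [_ [a ->] <-].
rewrite setTI.
pose Q (z : n.-tuple rat * rat) : Rn R n := [tuple ratr (tnth z.1 i) | i < n].
pose G (z : n.-tuple rat * rat) : set (Rn R n) :=
  if `[< eball (Q z) (ratr z.2) `<=` b @^-1` `]a, +oo[ >]
  then eball (Q z) (ratr z.2) else set0.
have -> : b @^-1` `]a, +oo[%classic = \bigcup_z G z.
  apply/seteqP; split => x; last first.
    by move=> [z _]; rewrite /G; case: ifPn => [/asboolP sub|_ //]; exact: sub.
  rewrite /= in_itv/= andbT => abx.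
  pose e := ((b x - a) / C) `^ dl^-1.
  have e0 : 0 < e by rewrite powR_gt0// divr_gt0// subr_gt0.
  have close y : edist x y < e -> a < b y.
    move=> xy; have : `|b x - b y| < b x - a.
      apply: le_lt_trans (bC x y) _; rewrite mulrC -ltr_pdivlMr//.
      have -> : (b x - a) / C = e `^ dl.
        rewrite -powRrM mulVf ?gt_eqF// powRr1// divr_ge0 ?subr_ge0//; exact: ltW.
      by rewrite gt0_ltr_powR// nnegrE// ltW.
    by move=> /ltr_normlW; lra.
  have e20 : 0 < e / 2 by rewrite divr_gt0.
  have [r] := rat_in_itvoo e20; rewrite in_itv/= => /andP[r0 re].
  have rn0 i : tnth x i < tnth x i + ratr r / n.+1%:R by rewrite ltrDl divr_gt0.
  have /choice[q qP] : forall i, exists q, ratr q \in `](tnth x i), (tnth x i + ratr r / n.+1%:R)[.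
    by move=> i; exact: rat_in_itvoo.
  pose z := ([tuple q i | i < n], r).
  have Qx : edist (Q z) x < ratr r.
    apply: eudist_lt => // i; rewrite /Q !tnth_mktuple.
    have := qP i; rewrite in_itv/=; set u := _ / n.+1%:R => /andP[? ?].
    by rewrite ler_norml; apply/andP; split; lra.
  exists z => //; rewrite /G asboolT// => y /= zy.
  rewrite /= in_itv/= andbT; apply: close.
  apply: le_lt_trans (eudist_triangle (Q z) _ _) _.
  by rewrite eudistC; move: zy; rewrite /eball/=; lra.
apply: countable_bigcupT_measurable; first exact: countableP.
by move=> z; rewrite /G; case: ifP.
Qed.

End lipschitz.

(** * Young's inequality for the norms of Lebesgue spaces *)

(** The function [t |-> `|t| ^ p], which turns a function with norm at most [1]
    in [L^p] into a density with integral at most [1].  For [p = +oo] it is [0]: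
    a bounded factor is absorbed by its bound. *)
Definition power_density {R : realType} (p : \bar R) (t : R) : R :=
  if p is r%:E then `|t| `^ r else 0.

Section young.
Context {d : measure_display} {T : measurableType d} {R : realType}.
Variable mu : {measure set T -> \bar R}.
Local Notation "p ^*" := (hoelder_conjugate p) : ereal_scope.

Lemma ae_eq_Lnorm (p : \bar R) (f g : T -> \bar R) : ae_eq mu [set: T] f g ->
  'N[mu]_p[f]%E = 'N[mu]_p[g]%E.
Proof.
move=> fg; rewrite unlock; case: p => [r| |].
- congr (_ `^ _)%E; apply: ae_eq_integral_any.
  exact: (ae_eq_comp (fun t => (`|t| `^ r)%E) fg).
- case: ifP => // _; apply: eq_ess_sup; apply: filterS fg => x /(_ I) /= ->//.
- case: ifP => // _; apply: eq_ess_inf; apply: filterS fg => x /(_ I) /= ->//.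
Qed.

Lemma power_density_ge0 (p : \bar R) (t : R) : 0 <= power_density p t.
Proof. by case: p => [r| |]//=; exact: powR_ge0. Qed.

Lemma measurable_power_density (p : \bar R) (f : T -> R) :
  measurable_fun [set: T] f ->
  measurable_fun [set: T] (fun x => power_density p (f x)).
Proof.
move=> mf; case: p => [r| |]/=; [|exact: measurable_cst|exact: measurable_cst].
apply: (measurableT_comp (measurable_powR r)).
exact: measurableT_comp.
Qed.

Lemma power_density_integral (p : \bar R) (a : T -> R) (N : R) : (1 <= p)%E ->
  0 < N -> measurable_fun [set: T] a -> ('N[mu]_p[EFin \o a] <= N%:E)%E ->
  (\int[mu]_x (power_density p (a x / N))%:E <= 1)%E.
Proof.
case: p => [r| |]//= p1 N0 ma aN; last by rewrite integral0.
rewrite lee_fin in p1; have r0 : 0 < r by apply: lt_le_trans p1.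
have H : (\int[mu]_x (`|a x| `^ r)%:E <= (N `^ r)%:E)%E.
  have <- : ('N[mu]_r%:E[EFin \o a] `^ r = \int[mu]_x (`|a x| `^ r)%:E)%E.
    exact: poweR_Lnorm (lt0r_neq0 r0).
  rewrite -poweR_EFin; apply: gt0_ler_poweR => //; first exact: ltW.
  - by rewrite in_itv/= leey andbT Lnorm_ge0.
  - by rewrite in_itv/= leey andbT lee_fin ltW.
rewrite (_ : (fun x => _) = fun x => ((N `^ r)^-1%:E * (`|a x| `^ r)%:E)%E); last first.
  apply/funext => x; rewrite -EFinM normrM powRM// normfV (gtr0_norm N0) mulrC.
  by rewrite -(powR_inv1 (ltW N0)) -powRrM mulN1r powRN.
rewrite ge0_integralZl_EFin//.
- rewrite -(mulVf (lt0r_neq0 (powR_gt0 r N0))) EFinM.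
  by rewrite lee_wpmul2l// lee_fin invr_ge0 powR_ge0.
- apply/measurable_EFinP; apply: (measurableT_comp (measurable_powR r)).
  exact: measurableT_comp.
- by rewrite invr_ge0 powR_ge0.
Qed.

(** Young's inequality in normalized form, with a factor [k] split between the
    two powers; [fine p^-1] is [1 / p], with value [0] at [p = +oo].  The
    exponent of [k] is [1 / p' + 1 / (m p)]. *)
Lemma ae_young (p : \bar R) (m : nat) (a c : T -> R) (N V : R) :
  (0 < mu [set: T])%E -> (1 <= p)%E -> (0 < m)%N -> 0 < N -> 0 < V ->
  ('N[mu]_p[EFin \o a] <= N%:E)%E -> ('N[mu]_(p^*)[EFin \o c] <= V%:E)%E ->
  {ae mu, forall y, forall k : R, 0 <= k ->
    `|a y * c y| * k `^ (1 - fine p^-1 + fine p^-1 / m%:R) <=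
    N * V * (power_density p (a y / N) * k `^ m%:R^-1 +
             power_density (p^*)%E (c y / V) * k)}.
Proof.
move=> muT p1 m0 N0 V0.
have bound (f : T -> R) (M : R) : ('N[mu]_+oo[EFin \o f] <= M%:E)%E ->
    {ae mu, forall y, `|f y| <= M}.
  rewrite unlock muT => fM; apply: filterS (ess_sup_ge mu (abse \o (EFin \o f))).
  by move=> y /= fy; have := le_trans fy fM; rewrite lee_fin.
have mk (k : R) : 0 <= k -> 0 <= k `^ m%:R^-1 by move=> _; exact: powR_ge0.
case: p p1 => [r| |]//; last first.
  move=> _ aN _; apply: filterS (bound _ _ aN) => y ay k k0.
  rewrite hoelder_conjugatey invey/= mul0r addr0 subr0 powRr1// mul0r add0r.
  rewrite powRr1// !normrM normfV (gtr0_norm V0).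
  have -> : N * V * (`|c y| / V * k) = N * (`|c y| * k).
    by field; rewrite gt_eqF.
  by rewrite -mulrA ler_wpM2r// mulr_ge0.
rewrite lee_fin le_eqVlt => /predU1P[<-|r1].
  rewrite hoelder_conjugate1 inve1/= => aN cV; apply: filterS (bound _ _ cV) => y cy k k0.
  rewrite subrr add0r div1r mul0r addr0 powRr1// !normrM normfV (gtr0_norm N0).
  have -> : N * V * (`|a y| / N * k `^ m%:R^-1) = `|a y| * V * k `^ m%:R^-1.
    by field; rewrite gt_eqF.
  by rewrite ler_wpM2r ?powR_ge0// ler_wpM2l.
move=> _ _; apply: aeW => y k k0.
have r0 : 0 < r by lra.
have rr : 0 < r - 1 by lra.
have -> : (r%:E^* = (r / (r - 1))%:E)%E.
  rewrite /hoelder_conjugate/= eqe gt_eqF// -EFinB inver gt_eqF//.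
rewrite inver gt_eqF//=.
set s := r / (r - 1); have s0 : 0 < s by rewrite divr_gt0.
have rs : r^-1 + s^-1 = 1 by rewrite /s; field; rewrite gt_eqF ?gt_eqF.
pose A := `|a y / N| * k `^ (r^-1 / m%:R); pose B := `|c y / V| * k `^ (1 - r^-1).
have A0 : 0 <= A by rewrite mulr_ge0 ?powR_ge0.
have B0 : 0 <= B by rewrite mulr_ge0 ?powR_ge0.
have -> : `|a y * c y| * k `^ (1 - r^-1 + r^-1 / m%:R) = N * V * (A * B).
  rewrite powRD; last first.
    apply/implyP => /eqP; have : 0 < r^-1 / m%:R by rewrite divr_gt0 ?invr_gt0 ?ltr0n.
    have : 0 < s^-1 by rewrite invr_gt0.
    by lra.
  rewrite /A /B !normrM !normfV (gtr0_norm N0) (gtr0_norm V0).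
  by field; rewrite !gt_eqF.
rewrite ler_wpM2l ?(mulr_ge0 (ltW N0) (ltW V0))//.
apply: le_trans (conjugate_powR A0 B0 r0 s0 rs) _.
apply: lerD.
- apply: (@le_trans _ _ (A `^ r)).
    by rewrite ler_pdivrMr// ler_peMr ?powR_ge0 ?ltW.
  rewrite /A powRM ?powR_ge0// -powRrM mulrAC mulVf ?gt_eqF// mul1r//.
- have s1 : 1 <= s by rewrite /s ler_pdivlMr//; lra.
  apply: (@le_trans _ _ (B `^ s)).
    by rewrite ler_pdivrMr// ler_peMr ?powR_ge0.
  rewrite /B powRM ?powR_ge0// -powRrM.
  have -> : 1 - r^-1 = s^-1 by lra.
  by rewrite mulVf ?gt_eqF// powRr1.
Qed.

End young.

(** * Products of powers and the local potential *)

Section ereal_products.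
Context {R : realType}.
Implicit Types x y : \bar R.
Local Open Scope ereal_scope.

Lemma lee_prod (I : Type) (s : seq I) (f g : I -> \bar R) :
  (forall i, 0 <= f i) -> (forall i, f i <= g i) ->
  \prod_(i <- s) f i <= \prod_(i <- s) g i.
Proof.
move=> f0 fg; elim: s => [|i s IH]; first by rewrite !big_nil.
by rewrite !big_cons lee_pmul// prode_ge0.
Qed.

Lemma prode_cst (m : nat) x : \prod_(i < m) x = x ^+ m.
Proof. by rewrite big_const_ord iter_mule mule1. Qed.

Lemma lee_expe (m : nat) x y : 0 <= x -> x <= y -> x ^+ m <= y ^+ m.
Proof. by move=> x0 xy; rewrite -!prode_cst; exact: lee_prod. Qed.

Lemma prode_le_sum_expe (m : nat) (f : 'I_m -> \bar R) : (0 < m)%N ->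
  (forall i, 0 <= f i) -> \prod_(i < m) f i <= \sum_(i < m) (f i) ^+ m.
Proof.
case: m f => // m f _ f0.
have [i0 Hi0] : exists i0, forall i, f i <= f i0.
  by exists [arg max_(i > ord0) f i]%O; case: arg_maxP => //= i _ H j; exact: H.
apply: (@le_trans _ _ (f i0 ^+ m.+1)).
  by rewrite -prode_cst; exact: lee_prod.
by rewrite (bigD1 i0)// leeDl//; apply: sume_ge0 => i _; exact: expe_ge0.
Qed.

Lemma expeM (m : nat) x y : (x * y) ^+ m = x ^+ m * y ^+ m.
Proof. by elim: m => [|m IH]; rewrite ?expe0 ?mule1// !expeS IH muleACA. Qed.

Lemma lee_expeD (m : nat) x y : 0 <= x -> 0 <= y ->
  (x + y) ^+ m <= (2 ^+ m)%:E * (x ^+ m + y ^+ m).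
Proof.
wlog xy : x y / x <= y => [H x0 y0|x0 y0].
  have [|/ltW] := leP x y => xy; first exact: H.
  by rewrite (addeC x) (addeC (x ^+ m)); exact: H.
apply: (@le_trans _ _ ((2%:E * y) ^+ m)).
  apply: lee_expe; first exact: adde_ge0.
  by rewrite mule_natl mule2n leeD2r.
rewrite expeM EFin_expe lee_wpmul2l ?expe_ge0// ?lee_fin//.
by rewrite leeDr// expe_ge0.
Qed.

End ereal_products.

Section weighted_products.
Context {d : measure_display} {T : measurableType d} {R : realType}.
Variable mu : {measure set T -> \bar R}.

(** A product of [m] integrals of the form produced by [ae_young] is at most a
    sum of integrals that are linear in the kernel [k].  The product is at most
    the sum of the [m]-th powers, and Jensen's inequality applies to each power:
    with the density [A i] for the first term, with [k / ka] for the second. *)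
Lemma prod_integral_le (m : nat) (ka : R) (k : T -> R) (A C : 'I_m -> T -> R) :
  (0 < m)%N -> 0 < ka -> measurable_fun [set: T] k -> (forall y, 0 <= k y) ->
  (\int[mu]_y (k y)%:E <= ka%:E)%E ->
  (forall i, measurable_fun [set: T] (A i)) -> (forall i y, 0 <= A i y) ->
  (forall i, measurable_fun [set: T] (C i)) -> (forall i y, 0 <= C i y) ->
  (forall i, (\int[mu]_y (A i y)%:E <= 1)%E) ->
  (\prod_(i < m) \int[mu]_y (A i y * k y `^ m%:R^-1 + C i y * k y)%:E <=
   (2 ^+ m)%:E * \sum_(i < m) (\int[mu]_y (A i y * k y)%:E +
     (ka ^+ m.-1)%:E * \int[mu]_y (C i y ^+ m * k y)%:E))%E.
Proof.
move=> m0 ka0 mk k0 kle mA A0 mC C0 A1.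
have mkm : measurable_fun [set: T] (fun y => k y `^ m%:R^-1).
  exact: (measurableT_comp (measurable_powR m%:R^-1)).
have km y : (k y `^ m%:R^-1) ^+ m = k y.
  by rewrite -powR_mulrn ?powR_ge0// -powRrM mulVf ?pnatr_eq0 ?gtn_eqF// powRr1.
have step i : ((\int[mu]_y (A i y * k y `^ m%:R^-1 + C i y * k y)%:E) ^+ m <=
   (2 ^+ m)%:E * (\int[mu]_y (A i y * k y)%:E +
     (ka ^+ m.-1)%:E * \int[mu]_y (C i y ^+ m * k y)%:E))%E.
  have -> : (\int[mu]_y (A i y * k y `^ m%:R^-1 + C i y * k y)%:E =
      \int[mu]_y (A i y * k y `^ m%:R^-1)%:E + \int[mu]_y (C i y * k y)%:E)%E.
    under eq_integral do rewrite EFinD.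
    rewrite ge0_integralD//.
    - by move=> y _; rewrite lee_fin mulr_ge0// powR_ge0.
    - by apply/measurable_EFinP; exact: measurable_funM.
    - by move=> y _; rewrite lee_fin mulr_ge0.
    - by apply/measurable_EFinP; exact: measurable_funM.
  have P0 : (0 <= \int[mu]_y (A i y * k y `^ m%:R^-1)%:E)%E.
    by apply: integral_ge0 => y _; rewrite lee_fin mulr_ge0// powR_ge0.
  have U0 : (0 <= \int[mu]_y (C i y * k y)%:E)%E.
    by apply: integral_ge0 => y _; rewrite lee_fin mulr_ge0.
  apply: le_trans (lee_expeD m P0 U0) _.
  rewrite lee_wpmul2l ?lee_fin ?exprn_ge0//; apply: leeD.
    apply: le_trans (pow_integral_le m0 (A0 i) (fun y => powR_ge0 (k y) _) (mA i) mkm (A1 i)) _.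
    by under eq_integral do rewrite km.
  pose a y := ka^-1 * k y.
  have a0 y : 0 <= a y by rewrite mulr_ge0// invr_ge0 ltW.
  have ma : measurable_fun [set: T] a by exact: measurable_funM.
  have a1 : (\int[mu]_y (a y)%:E <= 1)%E.
    rewrite /a; under eq_integral do rewrite EFinM.
    rewrite ge0_integralZl_EFin//; last 3 first.
    - by move=> y _; rewrite lee_fin.
    - exact/measurable_EFinP.
    - by rewrite invr_ge0 ltW.
    apply: le_trans (lee_wpmul2l _ kle) _; first by rewrite lee_fin invr_ge0 ltW.
    by rewrite -EFinM mulVf// gt_eqF.
  have Ca (h : T -> R) : (forall y, 0 <= h y) -> measurable_fun [set: T] h ->
      (\int[mu]_y (h y * k y)%:E = ka%:E * \int[mu]_y (a y * h y)%:E)%E.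
    move=> h0 mh; rewrite -ge0_integralZl_EFin//.
    - apply: eq_integral => y _; rewrite -EFinM /a; congr EFin.
      by field; rewrite gt_eqF.
    - by move=> y _; rewrite lee_fin mulr_ge0.
    - by apply/measurable_EFinP; exact: measurable_funM.
    - exact: ltW.
  rewrite Ca// expeM -EFin_expe Ca; last 2 first.
  - by move=> y; exact: exprn_ge0.
  - exact: measurable_funX.
  rewrite muleA -EFinM -exprSr prednK// lee_wpmul2l ?lee_fin ?exprn_ge0//; first exact: ltW.
  exact: pow_integral_le.
apply: le_trans (prode_le_sum_expe m0 _) _.
  by move=> i; apply: integral_ge0 => y _; rewrite lee_fin addr_ge0// mulr_ge0// powR_ge0.
rewrite ge0_sume_distrr; last first.
  move=> i _; rewrite adde_ge0//; last first.
    rewrite mule_ge0// ?lee_fin ?exprn_ge0//; first exact: ltW.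
    by apply: integral_ge0 => y _; rewrite lee_fin mulr_ge0// exprn_ge0.
  by apply: integral_ge0 => y _; rewrite lee_fin mulr_ge0.
exact: lee_sum.
Qed.

End weighted_products.

Section local_estimate.
Context {R : realType} {n : nat}.
Implicit Types (x y z : Rn R n).
Local Notation leb := (@lebn R n).

(** The kernel of the Riesz potential of exponent [sg], restricted to [S] in the
    second variable and normalized at the scale [rho]. *)
Definition riesz_kernel (sg rho : R) (S : set (Rn R n)) x y : R :=
  \1_S y * (edist x y / rho) `^ (- sg).

Lemma riesz_kernel_ge0 sg rho S x y : 0 <= riesz_kernel sg rho S x y.
Proof. by rewrite mulr_ge0// powR_ge0. Qed.

Lemma measurable_riesz_kernel sg rho S d (T : measurableType d) (f g : T -> Rn R n) :
  measurable S ->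
  measurable_fun [set: T] f -> measurable_fun [set: T] g ->
  measurable_fun [set: T] (fun t => riesz_kernel sg rho S (f t) (g t)).
Proof.
move=> mS mf mg; apply: measurable_funM.
  have mi : measurable_fun [set: Rn R n] (\1_S : Rn R n -> R) by exact: measurable_indic.
  exact: (measurableT_comp mi mg).
apply: (measurableT_comp (measurable_powR _)).
by apply: measurable_funM => //; exact: measurable_eudist.
Qed.

(** The integral of the kernel over a ball is uniformly bounded, and so is the
    potential as an operator on [L^1] of the ball, by Tonelli's theorem. *)
Lemma integral_riesz_kernel (sg : R) : 0 <= sg < n%:R -> exists2 C : R, 0 < C &
  forall z (rho : R), 0 < rho -> let S := eball z (rho / 2) in
    (forall x, S x ->
      (\int[leb]_y (riesz_kernel sg rho S x y)%:E <= (C * rho ^+ n)%:E)%E) /\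
    (forall h : Rn R n -> R, measurable_fun [set: Rn R n] h -> (forall y, 0 <= h y) ->
      (\int[leb]_(x in S) \int[leb]_y (h y * riesz_kernel sg rho S x y)%:E <=
       (C * rho ^+ n)%:E * \int[leb]_(y in S) (h y)%:E)%E).
Proof.
move=> sgn; have [C C0 HC] := integral_eudist_powRN sgn.
exists C => // z rho rho0 S.
have SS x y : S x -> S y -> edist x y < rho.
  rewrite /S /eball/= => zx zy; apply: le_lt_trans (eudist_triangle z x y) _.
  by rewrite eudistC; lra.
have mS : measurable S by exact: measurable_eball.
have K1 x : S x -> (\int[leb]_y (riesz_kernel sg rho S x y)%:E <= (C * rho ^+ n)%:E)%E.
  move=> Sx; apply: le_trans (HC x rho rho0).
  rewrite [leRHS]integral_mkcond; apply: ge0_le_integral_any => y _.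
    by rewrite lee_fin riesz_kernel_ge0.
  rewrite patchE /riesz_kernel indicE.
  have [|_] := boolP (y \in S); last first.
    by rewrite mul0r; case: ifPn => // _; rewrite lee_fin powR_ge0.
  by rewrite inE => Sy; rewrite mem_set ?mul1r//; exact: SS.
split => // h mh h0.
pose H x y := (\1_S x * (h y * riesz_kernel sg rho S x y))%:E.
have H0 (u : Rn R n * Rn R n) : (0 <= H u.1 u.2)%E.
  by rewrite lee_fin mulr_ge0// mulr_ge0// riesz_kernel_ge0.
have mH : measurable_fun [set: Rn R n * Rn R n] (fun u => H u.1 u.2).
  apply/measurable_EFinP; apply: measurable_funM.
    have mi : measurable_fun [set: Rn R n] (\1_S : Rn R n -> R) by exact: measurable_indic.
    exact: (measurableT_comp mi measurable_fst).
  apply: measurable_funM; first exact: (measurableT_comp mh measurable_snd).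
  exact: measurable_riesz_kernel.
have -> : (\int[leb]_(x in S) \int[leb]_y (h y * riesz_kernel sg rho S x y)%:E =
           \int[leb]_x \int[leb]_y H x y)%E.
  rewrite integral_mkcond; apply: eq_integral => x _; rewrite patchE /H indicE.
  case: ifPn => _ /=; first by under [RHS]eq_integral do rewrite mul1r.
  by rewrite integral0_eq// => y _; rewrite mul0r.
rewrite (@fubini_tonelli _ _ _ _ _ leb leb (fun u => H u.1 u.2))//.
have -> : ((C * rho ^+ n)%:E * \int[leb]_(y in S) (h y)%:E =
    \int[leb]_(y in S) ((C * rho ^+ n)%:E * (h y)%:E))%E.
  rewrite ge0_integralZl_EFin//.
  - by move=> y _; rewrite lee_fin.
  - by apply/measurable_EFinP; exact: measurable_funS mh.
  - by rewrite mulr_ge0 ?exprn_ge0// ltW.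
rewrite [leRHS]integral_mkcond; apply: ge0_le_integral_any => y _.
  by apply: integral_ge0 => x _; exact: (H0 (x, y)).
rewrite patchE /=.
case: ifPn => [|/negP] Sy; last first.
  rewrite integral0_eq// => x _; rewrite /H /riesz_kernel [\1_S y]indicE.
  by rewrite (negbTE (introN idP Sy)) mul0r !mulr0.
have -> : (\int[leb]_x H x y = (h y)%:E * \int[leb]_x (riesz_kernel sg rho S y x)%:E)%E.
  rewrite -ge0_integralZl_EFin//.
  - apply: eq_integral => x _; rewrite /H /riesz_kernel !indicE Sy mul1r -EFinM eudistC.
    by congr EFin; ring.
  - by move=> x _; rewrite lee_fin riesz_kernel_ge0.
  - by apply/measurable_EFinP; exact: measurable_riesz_kernel.
rewrite [leRHS]muleC lee_wpmul2l ?lee_fin//; apply: K1; exact: set_mem.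
Qed.

(** On a ball an [m]-linear fractional integral of densities [A i] in [L^1] and
    [C i] in [L^m] is dominated, pointwise, by a function with a controlled
    integral. *)
Lemma local_dominant (m : nat) (sg c0 : R) : (0 < m)%N -> 0 <= sg < n%:R -> 0 <= c0 ->
  exists2 M : R, 0 < M & forall z (rho : R) (A C : 'I_m -> Rn R n -> R), 0 < rho ->
    let S := eball z (rho / 2) in
    (forall i, measurable_fun [set: Rn R n] (A i)) -> (forall i y, 0 <= A i y) ->
    (forall i, measurable_fun [set: Rn R n] (C i)) -> (forall i y, 0 <= C i y) ->
    (forall i, (\int[leb]_y (A i y)%:E <= 1)%E) ->
    (forall i, (((rho ^+ n) ^+ m.-1)%:E * \int[leb]_(y in S) (C i y ^+ m)%:E <= c0%:E)%E) ->
    exists W : Rn R n -> \bar R,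
      [/\ measurable_fun [set: Rn R n] W, forall x, (0 <= W x)%E,
          (\int[leb]_(x in S) W x <= (M * rho ^+ n)%:E)%E &
          forall x, S x ->
            (\prod_(i < m) \int[leb]_y (A i y * riesz_kernel sg rho S x y `^ m%:R^-1 +
                C i y * riesz_kernel sg rho S x y)%:E <= W x)%E].
Proof.
move=> m0 sgn c00; have [C0 C00 HC0] := integral_riesz_kernel sgn.
exists (2 ^+ m * (\sum_(i < m) (C0 + C0 * C0 ^+ m.-1 * c0))).
  rewrite mulr_gt0 ?exprn_gt0// sumr_const card_ord pmulrn_lgt0//.
  by rewrite ltr_pwDl// !mulr_ge0// ?exprn_ge0// ltW.
move=> z rho A C rho0 S mA A0 mC C0' A1 Cc.
have [K1 K2] := HC0 z rho rho0; rewrite -/S in K1 K2.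
set ka := C0 * rho ^+ n; have ka0 : 0 < ka by rewrite mulr_gt0// exprn_gt0.
have mS : measurable S by exact: measurable_eball.
pose I (h : Rn R n -> R) x : \bar R := (\int[leb]_y (h y * riesz_kernel sg rho S x y)%:E)%E.
have I0 (h : Rn R n -> R) : (forall y, 0 <= h y) -> forall x, (0 <= I h x)%E.
  by move=> h0 x; apply: integral_ge0 => y _; rewrite lee_fin mulr_ge0 ?riesz_kernel_ge0.
have mI (h : Rn R n -> R) : (forall y, 0 <= h y) -> measurable_fun [set: Rn R n] h ->
    measurable_fun [set: Rn R n] (I h).
  move=> h0 mh.
  have := @measurable_fun_fubini_tonelli_F _ _ _ _ R leb
    (fun u : Rn R n * Rn R n => (h u.2 * riesz_kernel sg rho S u.1 u.2)%:E).
  apply.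
  - apply/measurable_EFinP; apply: measurable_funM; first exact: (measurableT_comp mh measurable_snd).
    exact: measurable_riesz_kernel.
  - by move=> u; rewrite lee_fin mulr_ge0 ?riesz_kernel_ge0.
pose Cm i y := C i y ^+ m.
have Cm0 i y : 0 <= Cm i y by exact: exprn_ge0.
have mCm i : measurable_fun [set: Rn R n] (Cm i) by exact: measurable_funX.
have kam : (0 <= (ka ^+ m.-1)%:E)%E by rewrite lee_fin exprn_ge0// ltW.
have t0 i x : (0 <= I (A i) x + (ka ^+ m.-1)%:E * I (Cm i) x)%E.
  by rewrite adde_ge0 ?I0// mule_ge0// I0.
have mt i : measurable_fun [set: Rn R n] (fun x => I (A i) x + (ka ^+ m.-1)%:E * I (Cm i) x)%E.
  apply: emeasurable_funD; first exact: mI.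
  by apply: measurable_funeM; exact: mI.
exists (fun x => (2 ^+ m)%:E * \sum_(i < m) (I (A i) x + (ka ^+ m.-1)%:E * I (Cm i) x))%E.
split.
- by apply: measurable_funeM; exact: emeasurable_sum.
- by move=> x; rewrite mule_ge0 ?sume_ge0// lee_fin exprn_ge0.
- rewrite ge0_integralZl_EFin ?exprn_ge0//; last 2 first.
  + by move=> x _; rewrite sume_ge0.
  + by apply: measurable_funTS; exact: emeasurable_sum.
  rewrite -mulrA EFinM lee_wpmul2l ?lee_fin ?exprn_ge0//.
  rewrite ge0_integral_sum//; last by move=> i; exact: measurable_funTS.
  rewrite mulr_suml -sumEFin; apply: lee_sum => i _.
  rewrite ge0_integralD//; last 4 first.
  + by move=> x _; exact: I0.
  + by apply: measurable_funTS; exact: mI.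
  + by move=> x _; rewrite mule_ge0// I0.
  + by apply: measurable_funTS; apply: measurable_funeM; exact: mI.
  rewrite mulrDl EFinD; apply: leeD.
    apply: le_trans (K2 _ (mA i) (A0 i)) _.
    rewrite -[leRHS]mule1 lee_wpmul2l ?lee_fin ?(ltW ka0)//.
    apply: le_trans (A1 i); rewrite integral_mkcond; apply: ge0_le_integral_any => y _.
      by apply: erestrict_ge0 => y' _; rewrite lee_fin.
    by rewrite patchE; case: ifPn => // _; rewrite lee_fin.
  rewrite ge0_integralZl_EFin ?exprn_ge0 ?(ltW ka0)//; last 2 first.
  + by move=> x _; exact: I0.
  + by apply: measurable_funTS; exact: mI.
  apply: le_trans (lee_wpmul2l kam (K2 _ (mCm i) (Cm0 i))) _.
  have := Cc i; rewrite -/(Cm i).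
  have : (0 <= \int[leb]_(y in S) (Cm i y)%:E)%E.
    by apply: integral_ge0 => y _; rewrite lee_fin.
  have -> : (\int[leb]_(y in S) (C i y ^+ m)%:E = \int[leb]_(y in S) (Cm i y)%:E)%E by [].
  set J := (\int[leb]_(y in S) (Cm i y)%:E)%E => J0 H.
  have -> : ((ka ^+ m.-1)%:E * ((C0 * rho ^+ n)%:E * J) =
     (C0 * C0 ^+ m.-1 * rho ^+ n)%:E * (((rho ^+ n) ^+ m.-1)%:E * J))%E.
    by rewrite !muleA -!EFinM; congr (_%:E * _)%E; rewrite /ka exprMn; ring.
  have -> : C0 * C0 ^+ m.-1 * c0 * rho ^+ n = C0 * C0 ^+ m.-1 * rho ^+ n * c0 by ring.
  rewrite [leRHS]EFinM lee_wpmul2l// lee_fin !mulr_ge0// ?exprn_ge0//; exact: ltW.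
- move=> x Sx; apply: prod_integral_le => //.
  + exact: measurable_riesz_kernel.
  + by move=> y; exact: riesz_kernel_ge0.
  + exact: K1.
Qed.

End local_estimate.

(** * Pointwise estimate of the kernel of the commutator *)

Section powers.
Context {R : realType}.
Implicit Types a c t : R.

Lemma gt0_powRD a c t : 0 < a -> a `^ (c + t) = a `^ c * a `^ t.
Proof. by move=> a0; rewrite powRD// (gt_eqF a0) implybT. Qed.

Lemma powR_sum (I : Type) (s : seq I) a (e : I -> R) : 0 < a ->
  a `^ (\sum_(i <- s) e i) = \prod_(i <- s) a `^ e i.
Proof.
move=> a0; apply: (big_morph (powR a)); last exact: powRr0.
by move=> u v; exact: gt0_powRD.
Qed.

Lemma ler_powRN a c t : 0 < a -> a <= c -> 0 <= t -> c `^ (- t) <= a `^ (- t).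
Proof.
move=> a0 ac t0; have c0 := lt_le_trans a0 ac.
rewrite !powRN lef_pV2 ?posrE ?powR_gt0//.
by rewrite ge0_ler_powR// nnegrE ltW.
Qed.

Lemma powR_half a t : 0 < a -> (a / 2) `^ (- t) = 2 `^ t * a `^ (- t).
Proof.
move=> a0; rewrite powRM ?(ltW a0) ?invr_ge0// mulrC; congr (_ * _).
by rewrite -powR_inv1// -powRrM mulN1r opprK.
Qed.

End powers.

Section kernel_estimate.
Context {R : realType} {n m : nat}.
Implicit Types (x z : Rn R n) (y : m.-tuple (Rn R n)).

Lemma dist_sum_ge x y i : edist x (tnth y i) <= dist_sum x y.
Proof. by rewrite /dist_sum (bigD1 i)//= lerDl sumr_ge0. Qed.

Lemma dist_sum_le x z y : dist_sum x y <= dist_sum z y + m%:R * edist x z.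
Proof.
have -> : m%:R * edist x z = \sum_(i < m) edist x z.
  by rewrite sumr_const card_ord mulr_natl.
rewrite /dist_sum -big_split/=; apply: ler_sum => i _.
by rewrite addrC; exact: eudist_triangle.
Qed.

Variables (al ga dl : R) (K : Rn R n -> m.-tuple (Rn R n) -> R).
Variable b : 'I_m -> Rn R n -> R.
Hypotheses (m0 : (0 < m)%N) (al_lt : al < (m * n)%:R) (dl0 : 0 < dl)
  (dlga : dl < ga).
Hypotheses (Ksize : kernel_size al K) (Ksmooth : kernel_smooth al ga K).
Hypothesis bL : forall i, Lipschitz_space dl (b i).

Let common_lipschitz : exists2 L : R, 0 < L &
  forall j x z, `|b j x - b j z| <= L * edist x z `^ dl.
Proof.
have /choice[C HC] := bL.
exists (1 + \sum_i `|C i|); first by rewrite ltr_pwDl// sumr_ge0.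
move=> j x z; apply: le_trans (HC j x z) _; rewrite ler_wpM2r ?powR_ge0//.
apply: le_trans (ler_norm _) _; rewrite (bigD1 j)//=.
have : 0 <= \sum_(i < m | i != j) `|C i| by apply: sumr_ge0.
lra.
Qed.

Let ka := (m * n)%:R - al.

Let ka0 : 0 < ka. Proof. by rewrite subr_gt0. Qed.

Let size_pos : exists2 C : R, 0 < C &
  forall x y, 0 < dist_sum x y -> `|K x y| <= C * dist_sum x y `^ (- ka).
Proof.
have [C HC] := Ksize; exists (`|C| + 1); first by rewrite ltr_pwDr.
move=> x y xy; apply: le_trans (HC x y xy) _; rewrite ler_wpM2r ?powR_ge0//.
by rewrite (le_trans (ler_norm _))// lerDl.
Qed.

Let ckD x x' y : commutator_kernel K b x y - commutator_kernel K b x' y =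
  \sum_(j < m) ((b j x - b j x') * K x y +
                (b j x' - b j (tnth y j)) * (K x y - K x' y)).
Proof.
rewrite /commutator_kernel -sumrB; apply: eq_bigr => j _; ring.
Qed.

(** The first product bounds the difference when [dist_sum z y >= M * r], by the
    smoothness of the kernel; the other two bound it in the opposite case, where
    all the [tnth y i] belong to the ball of radius [M * r], by the size of the
    kernel. *)
Lemma commutator_kernel_le (be th : 'I_m -> R) :
  (forall i, be i < n%:R) -> \sum_i be i = al + dl ->
  (forall i, 0 <= th i) -> \sum_i th i = (m * n)%:R - (al + dl) ->
  exists2 M : R, 1 <= M & exists2 C : R, 0 < C &
    forall z (r : R) x x' y, 0 < r -> edist z x < r -> edist z x' < r ->
    (forall i, 0 < edist x (tnth y i)) -> (forall i, 0 < edist x' (tnth y i)) ->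
    `|commutator_kernel K b x y - commutator_kernel K b x' y| <=
    C * (r `^ dl * \prod_(i < m) (r + edist z (tnth y i)) `^ (- (n%:R - be i + dl / m%:R)) +
         \prod_(i < m) (\1_(eball z (M * r)) (tnth y i) * edist x (tnth y i) `^ (- th i)) +
         \prod_(i < m) (\1_(eball z (M * r)) (tnth y i) * edist x' (tnth y i) `^ (- th i))).
Proof.
move=> be_n sum_be th0 sum_th.
have [L L0 HL] := common_lipschitz.
have [Cs Cs0 HCs] := size_pos.
have [Ck [c [Ck0 c0 HCk]]] := Ksmooth.
(* For dist_sum z y >= M * r and x, x' in the ball, dist_sum x y is at least
   dist_sum z y / 2, hence larger than c * edist x x'. *)
pose M := 2 * m%:R + 4 * c + 1.
have mR0 : 0 < (m%:R : R) by rewrite ltr0n.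
have M1 : 1 <= M by rewrite /M; lra.
pose C1 := m%:R * (L * 2 `^ dl * Cs * 2 `^ ka + L * 2 `^ dl * Ck * 2 `^ ga * 2 `^ (ka + ga)).
pose C2 := m%:R * (L * Cs).
pose e i := n%:R - be i + dl / m%:R.
have e0 i : 0 < e i by rewrite addr_gt0 ?subr_gt0// divr_gt0.
have sum_e : \sum_i e i = ka.
  have -> : \sum_i e i = \sum_(i < m) n%:R - \sum_i be i + \sum_(i < m) dl / m%:R.
    by rewrite -sumrB -big_split.
  rewrite sum_be !sumr_const card_ord -[n%:R *+ m]mulr_natr -[(dl / _) *+ m]mulr_natr.
  by rewrite divfK ?gt_eqF// /ka natrM; ring.
have C10 : 0 < C1.
  by rewrite mulr_gt0// addr_gt0 ?mulr_gt0 ?powR_gt0.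
have C20 : 0 < C2 by rewrite !mulr_gt0.
have near z (r : R) x y : dist_sum z y < M * r -> (forall i, 0 < edist x (tnth y i)) ->
    `|commutator_kernel K b x y| <= C2 *
    \prod_(i < m) (\1_(eball z (M * r)) (tnth y i) * edist x (tnth y i) `^ (- th i)).
  move=> zM xy.
  have X0 : 0 < dist_sum x y.
    by apply: lt_le_trans (dist_sum_ge x y (Ordinal m0)); exact: xy.
  apply: (@le_trans _ _ (C2 * dist_sum x y `^ (- ((m * n)%:R - (al + dl))))); last first.
    rewrite ler_pM2l// -sum_th -sumrN powR_sum//; apply: ler_prod => i _.
    rewrite powR_ge0/= indicE mem_set ?mul1r; last first.
      by rewrite /eball/=; apply: le_lt_trans zM; exact: dist_sum_ge.
    by apply: ler_powRN => //; exact: dist_sum_ge.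
  rewrite /commutator_kernel /C2.
  have -> : - ((m * n)%:R - (al + dl)) = dl - ka by rewrite /ka; ring.
  rewrite gt0_powRD//.
  apply: le_trans (ler_norm_sum _ _ _) _.
  apply: (@le_trans _ _ (\sum_(i < m) (L * Cs) * (dist_sum x y `^ dl * dist_sum x y `^ (- ka)))).
    apply: ler_sum => j _; rewrite normrM mulrACA ler_pM//; last exact: HCs.
    apply: le_trans (HL _ _ _) _; rewrite ler_pM2l//.
    by rewrite ge0_ler_powR ?nnegrE ?dist_sum_ge ?(ltW dl0) ?(ltW X0).
  by rewrite sumr_const card_ord -[_ *+ m]mulr_natl mulrA.
have far z (r : R) x x' y : 0 < r -> edist z x < r -> edist z x' < r -> M * r <= dist_sum z y ->
   `|commutator_kernel K b x y - commutator_kernel K b x' y| <=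
    C1 * (r `^ dl * dist_sum z y `^ (- ka)).
  move=> r0 zx zx' zM.
  have cr : 0 < c * r by rewrite mulr_gt0.
  have mr : 0 < m%:R * r by rewrite mulr_gt0.
  set Z := dist_sum z y in zM *; set X := dist_sum x y.
  have ZM : 2 * (m%:R * r) + 4 * (c * r) + r <= Z.
    by apply: le_trans zM; rewrite /M; lra.
  have Z0 : 0 < Z by lra.
  have XZ : Z / 2 <= X.
    have := dist_sum_le z x y; rewrite -/Z -/X.
    have : m%:R * edist z x <= m%:R * r by rewrite ler_pM2l// ltW.
    lra.
  have X0 : 0 < X by lra.
  have xx' : edist x x' <= 2 * r.
    apply: le_trans (eudist_triangle z _ _) _; rewrite eudistC; lra.
  have x'y j : edist x' (tnth y j) <= 2 * Z.
    apply: le_trans (eudist_triangle z _ _) _; rewrite eudistC.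
    have := dist_sum_ge z y j; rewrite -/Z; lra.
  have Kx : `|K x y| <= Cs * (2 `^ ka * Z `^ (- ka)).
    apply: le_trans (HCs x y X0) _; rewrite ler_pM2l// -powR_half//.
    by apply: ler_powRN => //; [rewrite divr_gt0|exact: ltW].
  have Kxx' : `|K x y - K x' y| <= Ck * (2 `^ ga * r `^ ga * (2 `^ (ka + ga) * Z `^ (- (ka + ga)))).
    apply: le_trans (HCk x x' y _) _.
      rewrite -/X; apply: le_lt_trans (_ : c * (2 * r) < X); first by rewrite ler_pM2l.
      lra.
    rewrite ler_pM2l//; apply: ler_pM; rewrite ?invr_ge0 ?powR_ge0//.
      rewrite -powRM ?(ltW r0)// ge0_ler_powR ?nnegrE ?mulr_ge0 ?(ltW r0)//.
      by apply: ltW; exact: lt_trans dlga.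
    rewrite -powR_half// -powRN -/ka; apply: ler_powRN => //; first by rewrite divr_gt0.
    by apply: ltW; rewrite addr_gt0// (lt_trans dl0).
  have rZ : Z `^ dl * (r `^ ga * Z `^ (- (ka + ga))) <= r `^ dl * Z `^ (- ka).
    have -> : Z `^ (- (ka + ga)) = Z `^ (- dl) * Z `^ (- (ga - dl)) * Z `^ (- ka).
      by rewrite -!gt0_powRD//; congr (_ `^ _); ring.
    have -> : r `^ ga = r `^ dl * r `^ (ga - dl).
      by rewrite -gt0_powRD//; congr (_ `^ _); ring.
    rewrite (_ : _ * _ = (Z `^ dl * Z `^ (- dl)) * (r `^ (ga - dl) * Z `^ (- (ga - dl))) *
      (r `^ dl * Z `^ (- ka))); last by ring.
    rewrite -gt0_powRD// subrr powRr0 mul1r.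
    rewrite -[leRHS]mul1r ler_wpM2r ?mulr_ge0 ?powR_ge0//.
    rewrite powRN ler_pdivrMr ?powR_gt0// mul1r.
    by rewrite ge0_ler_powR ?nnegrE ?subr_ge0 ?(ltW dlga) ?(ltW r0) ?(ltW Z0)//; lra.
  rewrite ckD; apply: le_trans (ler_norm_sum _ _ _) _.
  apply: (@le_trans _ _ (\sum_(j < m) (L * 2 `^ dl * Cs * 2 `^ ka +
     L * 2 `^ dl * Ck * 2 `^ ga * 2 `^ (ka + ga)) * (r `^ dl * Z `^ (- ka)))); last first.
    by rewrite sumr_const card_ord -[_ *+ m]mulr_natl mulrA.
  apply: ler_sum => j _; apply: le_trans (ler_normD _ _) _; rewrite [leRHS]mulrDl !normrM.
  apply: lerD.
    apply: (@le_trans _ _ ((L * (2 * r) `^ dl) * (Cs * (2 `^ ka * Z `^ (- ka))))).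
      apply: ler_pM => //; apply: le_trans (HL _ _ _) _; rewrite ler_pM2l//.
      by rewrite ge0_ler_powR ?nnegrE ?mulr_ge0 ?(ltW r0) ?(ltW dl0).
    by rewrite powRM ?(ltW r0)// le_eqVlt; apply/orP; left; apply/eqP; ring.
  apply: (@le_trans _ _ ((L * (2 * Z) `^ dl) *
      (Ck * (2 `^ ga * r `^ ga * (2 `^ (ka + ga) * Z `^ (- (ka + ga))))))).
    apply: ler_pM => //; apply: le_trans (HL _ _ _) _; rewrite ler_pM2l//.
    by rewrite ge0_ler_powR ?nnegrE ?mulr_ge0 ?(ltW Z0) ?(ltW dl0).
  rewrite powRM ?(ltW Z0)//.
  rewrite (_ : _ * _ * _ = L * 2 `^ dl * Ck * 2 `^ ga * 2 `^ (ka + ga) *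
    (Z `^ dl * (r `^ ga * Z `^ (- (ka + ga))))); last by ring.
  by rewrite ler_wpM2l// !mulr_ge0 ?powR_ge0// ltW.
exists M => //; exists (C1 * 2 `^ ka + C2); first by rewrite addr_gt0// mulr_gt0// powR_gt0.
move=> z r x x' y r0 zx zx' xy x'y.
set P0 := \prod_(i < m) _ `^ _; set P1 := \prod_(i < m) _; set P2 := \prod_(i < m) _.
have P00 : 0 <= P0 by apply: prodr_ge0 => i _; exact: powR_ge0.
have P10 : 0 <= P1 by apply: prodr_ge0 => i _; rewrite mulr_ge0 ?powR_ge0.
have P20 : 0 <= P2 by apply: prodr_ge0 => i _; rewrite mulr_ge0 ?powR_ge0.
have rd : 0 <= r `^ dl * P0 by rewrite mulr_ge0 ?powR_ge0.
have k2 : 0 <= C1 * 2 `^ ka by rewrite mulr_ge0 ?powR_ge0// ltW.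
have [zM|zM] := ltP (dist_sum z y) (M * r).
  apply: le_trans (ler_normB _ _) _.
  apply: le_trans (lerD (near z r x y zM xy) (near z r x' y zM x'y)) _.
  rewrite -/P1 -/P2; clearbody P0 P1 P2; rewrite -mulrDr -addrA.
  apply: ler_pM; rewrite ?(ltW C20) ?addr_ge0//; [by rewrite lerDr|by rewrite lerDr].
apply: le_trans (far z r x x' y r0 zx zx' zM) _.
have Z0 : 0 < dist_sum z y by apply: lt_le_trans zM; rewrite mulr_gt0//; lra.
have ZP : dist_sum z y `^ (- ka) <= 2 `^ ka * P0.
  rewrite -{1}sum_e -sumrN powR_sum// -{1}sum_e powR_sum// -big_split/=.
  apply: ler_prod => i _; rewrite powR_ge0/= -powR_half; last by rewrite ltr_pwDl.
  apply: ler_powRN; rewrite ?(ltW (e0 i))//.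
    by rewrite divr_gt0// ltr_pwDl.
  have := dist_sum_ge z y i.
  have : r <= M * r by rewrite ler_peMl// ltW.
  lra.
apply: (@le_trans _ _ (C1 * 2 `^ ka * (r `^ dl * P0))).
  rewrite -mulrA ler_pM2l// mulrCA ler_wpM2l ?powR_ge0//.
clearbody P0 P1 P2; apply: ler_pM => //; first by rewrite lerDl ltW.
by rewrite -addrA lerDl addr_ge0.
Qed.

End kernel_estimate.

(** * Norms, exponents and the reverse Hoelder condition *)

Section norms.
Context {d : measure_display} {T : measurableType d} {R : realType}.
Variable mu : {measure set T -> \bar R}.

Lemma ae_eq_integral_on (D : set T) (f g : T -> \bar R) :
  {ae mu, forall x, D x -> f x = g x} ->
  (\int[mu]_(x in D) f x = \int[mu]_(x in D) g x)%E.
Proof.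
move=> fg; rewrite (integral_mkcond D f) (integral_mkcond D g).
apply: ae_eq_integral_any; apply: filterS fg => x fg _.
by rewrite !patchE; case: ifPn => // /[!inE] /fg.
Qed.

Lemma Lnorm_le_scale (p : \bar R) (c : R) (f g : T -> R) : (1 <= p)%E -> 0 < c ->
  measurable_fun [set: T] g -> {ae mu, forall x, `|f x| <= c * `|g x|} ->
  ('N[mu]_p[EFin \o f] <= c%:E * 'N[mu]_p[EFin \o g])%E.
Proof.
rewrite unlock; case: p => [r| |]//.
- rewrite lee_fin => r1 c0 mg fg; have r0 : 0 < r by apply: lt_le_trans r1.
  have -> : (c%:E = (c%:E `^ r) `^ r^-1)%E.
    by rewrite -poweRrM divff ?gt_eqF// poweRe1// lee_fin ltW.
  rewrite -poweRM ?poweR_ge0//; last by apply: integral_ge0 => x _; exact: poweR_ge0.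
  have I0 (h : T -> \bar R) : (0 <= \int[mu]_x (`|h x| `^ r))%E.
    by apply: integral_ge0 => x _; exact: poweR_ge0.
  apply: gt0_ler_poweR.
  + by rewrite invr_ge0 ltW.
  + by rewrite in_itv/= leey andbT; exact: (I0 (EFin \o f)).
  + by rewrite in_itv/= leey andbT mule_ge0// ?lee_fin ?powR_ge0//; exact: (I0 (EFin \o g)).
  rewrite poweR_EFin -ge0_integralZl_EFin ?powR_ge0//.
  + apply: ae_ge0_le_integral_any => /=.
    * by move=> x _; rewrite lee_fin powR_ge0.
    * by move=> x _; rewrite -EFinM lee_fin mulr_ge0 ?powR_ge0.
    * apply: filterS fg => x fx _; rewrite -EFinM lee_fin -powRM ?(ltW c0)//.
      by rewrite ge0_ler_powR ?nnegrE ?mulr_ge0 ?(ltW c0) ?(ltW r0).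
  + by move=> x _; exact: poweR_ge0.
  + apply/measurable_EFinP; apply: (measurableT_comp (measurable_powR r)).
    exact: measurableT_comp.
- move=> _ c0 mg fg; case: ifP => muT; last by rewrite mule0.
  apply/ess_supP; apply: filterS2 fg (ess_sup_ge mu (abse \o (EFin \o g))) => x fx gx.
  apply: (@le_trans _ _ (c * `|g x|)%:E); first by rewrite /= lee_fin.
  by rewrite EFinM lee_wpmul2l// lee_fin ltW.
Qed.

Lemma Lnorm_gt0 (p : \bar R) (f : T -> R) : (1 <= p)%E -> (0 < mu [set: T])%E ->
  ae_measurable mu f -> {ae mu, forall x, 0 < f x} -> (0 < 'N[mu]_p[EFin \o f])%E.
Proof.
move=> p1 muT [g mg fg] f0; rewrite lt0e Lnorm_ge0 andbT; apply/eqP => N0.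
rewrite (ae_eq_Lnorm p (ae_eq_comp EFin fg)) in N0.
have g0 : ae_eq mu setT (EFin \o g) (cst 0%E).
  apply: Lnorm_eq0_eq0 N0; first exact/measurable_EFinP.
  by apply: lt_le_trans p1; exact: lte01.
have [N [mN N0' NT]] : {ae mu, forall x : T, False}.
  apply: filterS3 f0 fg g0 => x f0 /(_ I) fg /(_ I) /= [g0].
  by move: f0; rewrite fg g0 ltxx.
have : mu setT = 0%E.
  by apply: subset_measure0 N0' => //; move=> x _; exact: NT.
by move=> E; rewrite E ltxx in muT.
Qed.

End norms.

Section exponents.
Context {R : realType}.

Lemma fine_inve_itv (p : \bar R) : (1 <= p)%E ->
  [/\ (p^-1 \is a fin_num)%E, 0 <= fine p^-1%E & fine p^-1%E <= 1].
Proof.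
case: p => [r| |]//.
rewrite lee_fin => r1; have r0 : 0 < r by lra.
rewrite inver gt_eqF//=; split => //; first by rewrite invr_ge0 ltW.
by rewrite invf_le1.
Qed.

(** The exponents of the factors of the local kernel.  Since [1 / p < at_ / n],
    the sum of the coefficients of [sg] is larger than [m - at_ / n], which makes
    [sg] less than [n]. *)
Lemma local_exponent (n m : nat) (at_ : R) (p : 'I_m -> \bar R) : (0 < m)%N ->
  0 < at_ -> at_ < (m * n)%:R -> (forall i, 1 <= p i)%E ->
  ((n%:R / at_)%:E < (\sum_(i < m) (p i)^-1)^-1)%E ->
  exists2 sg : R, 0 <= sg < n%:R &
    \sum_(i < m) (sg * (1 - fine (p i)^-1%E + fine (p i)^-1%E / m%:R)) = (m * n)%:R - at_.
Proof.
move=> m0 at0 atmn p1 pn.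
have mR : 0 < (m%:R : R) by rewrite ltr0n.
have mR1 : 1 <= (m%:R : R) by rewrite ler1n.
pose q i := fine (p i)^-1%E.
have q0 i : 0 <= q i by have [] := fine_inve_itv (p1 i).
have q1 i : q i <= 1 by have [] := fine_inve_itv (p1 i).
have qE : (\sum_(i < m) (p i)^-1 = (\sum_(i < m) q i)%:E)%E.
  by rewrite -sumEFin; apply: eq_bigr => i _; rewrite fineK//; have [] := fine_inve_itv (p1 i).
set Q := \sum_(i < m) q i in qE.
have Q0 : 0 <= Q by apply: sumr_ge0.
have n0 : 0 < (n%:R : R).
  by rewrite ltr0n lt0n; apply: contraTneq atmn => ->; rewrite muln0 -leNgt ltW.
have nQ : n%:R * Q < at_.
  move: pn; rewrite qE; have [->|Qn0] := eqVneq Q 0; first by rewrite mulr0.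
  have {}Q0 : 0 < Q by rewrite lt0r Qn0.
  by rewrite inver gt_eqF// lte_fin ltr_pdivrMr// mulrC ltr_pdivlMr.
pose tau i := 1 - q i + q i / m%:R.
have sum_tau : \sum_i tau i = m%:R - Q + Q / m%:R.
  by rewrite /tau big_split sumrB/= sumr_const card_ord -mulr_suml.
have Qm : 0 <= Q / m%:R by rewrite divr_ge0// ltW.
have mn : (m * n)%:R = m%:R * n%:R :> R by rewrite natrM.
have tau0 : 0 < m%:R - Q + Q / m%:R.
  rewrite -(pmulr_rgt0 _ n0); nra.
exists (((m * n)%:R - at_) / (m%:R - Q + Q / m%:R)).
  apply/andP; split; first by rewrite divr_ge0 ?(ltW tau0)// subr_ge0 ltW.
  rewrite ltr_pdivrMr//; nra.
by rewrite -mulr_sumr sum_tau divfK// gt_eqF.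
Qed.

Lemma hoelder_conjugate_fin (p : \bar R) : (1 < p)%E ->
  exists2 q : R, 1 <= q & hoelder_conjugate p = q%:E.
Proof.
move=> p1; have := hoelder_conj_ge1 (ltW p1).
case E : (hoelder_conjugate p) => [q| |]//; first by rewrite lee_fin => q1; exists q.
by move=> _; move: p1; rewrite (hoelder_conjugate_eqy E) ltxx.
Qed.

End exponents.

Section reverse_hoelder_bound.
Context {R : realType} {n : nat}.
Local Notation leb := (@lebn R n).
Local Notation "p ^*" := (hoelder_conjugate p) : ereal_scope.

(** The reverse Hoelder condition on [v ^ (- p')] in normalized form: if the norm
    of [1 / v] on a ball is at most [V], then the [m]-th power of the density
    [(1 / (v V)) ^ p'] has an integral of the order of [|S| ^ (1 - m)].  The
    function [u] is a Borel version of [1 / v]. *)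
Lemma reverse_hoelder_density (m : nat) (p : \bar R) (v u : Rn R n -> R) :
  (0 < m)%N -> (1 <= p)%E -> {ae leb, forall x, 0 < v x} ->
  measurable_fun [set: Rn R n] u -> ae_eq leb setT (fun x => (v x)^-1) u ->
  ((1 < p)%E -> (1 < m)%N ->
     reverse_holder m%:R (fun x => v x `^ (- fine (p^*)%E))) ->
  exists2 c0 : R, 0 <= c0 & forall z (rho V : R), 0 < rho -> 0 < V ->
    let S := eball z (rho / 2) in
    ('N[leb]_(p^*)[EFin \o (fun y => u y * \1_S y)%R] <= V%:E)%E ->
    (((rho ^+ n) ^+ m.-1)%:E *
      \int[leb]_(y in S) (power_density (p^*)%E (u y * \1_S y / V) ^+ m)%:E <= c0%:E)%E.
Proof.
move=> m0 p1 v0 mu_ vu RH.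
have muS S : measurable S -> measurable_fun [set: Rn R n] (fun y => u y * \1_S y).
  by move=> mS; apply: measurable_funM.
move: p1; rewrite le_eqVlt => /predU1P[<-|p1].
  exists 0 => // z rho V _ _ S _; rewrite hoelder_conjugate1/=.
  by rewrite integral0_eq ?mule0// => y _; rewrite expr0n gtn_eqF.
have [q q1 pq] := hoelder_conjugate_fin p1; rewrite pq in RH *.
have q1E : (1 <= q%:E)%E by rewrite lee_fin.
have [m1|m1] := leqP m 1.
  have -> : m = 1%N by apply/eqP; rewrite eqn_leq m1.
  exists 1 => // z rho V rho0 V0 S uV; rewrite expr0 mul1e.
  apply: le_trans (power_density_integral q1E V0 (muS _ (measurable_eball _ _)) uV).
  rewrite [leLHS]integral_mkcond; apply: ge0_le_integral_any => y _.
    by apply: erestrict_ge0 => y' _; rewrite lee_fin exprn_ge0// power_density_ge0.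
  by rewrite patchE; case: ifPn => // _; rewrite lee_fin ?expr1 ?power_density_ge0.
have [_ [C0 HC0]] := RH p1 m1.
pose C : R := `|C0|.
have C00 : 0 <= C by exact: normr_ge0.
exists (((n.+1%:R ^+ n) ^+ m.-1) * C ^+ m); first by rewrite mulr_ge0// exprn_ge0.
move=> z rho V rho0 V0 S uV.
have r20 : 0 < rho / 2 by rewrite divr_gt0.
have mS : measurable S by exact: measurable_eball.
have vol0 := bvol_gt0 z r20.
have := HC0 z (rho / 2) r20; rewrite -/S /=; set B := bvol z (rho / 2) in vol0 *.
have q0 : 0 < q by lra.
(* On S, v ^ -q is V ^ q times the normalized density a. *)
pose a y := power_density q%:E (u y * \1_S y / V).
have a0 y : 0 <= a y by exact: power_density_ge0.
have ma : measurable_fun [set: Rn R n] a.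
  apply: measurable_power_density; apply: measurable_funM => //; exact: muS.
have va : {ae leb, forall y, S y -> v y `^ (- q) = V `^ q * a y}.
  apply: filterS2 v0 vu => y vy0 /(_ I) vuy Sy.
  rewrite /a/= indicE mem_set// mulr1 -vuy normrM !normfV !gtr0_norm//.
  by rewrite powRM ?invr_ge0 ?(ltW vy0) ?(ltW V0)// -!powR_inv1 ?(ltW vy0) ?(ltW V0)//
    -!powRrM !mulN1r mulrCA -powRD ?subrr ?powRr0 ?mulr1// (gt_eqF V0) implybT.
have E1 : (\int[leb]_(y in S) (v y `^ (- q))%:E = (V `^ q)%:E * \int[leb]_(y in S) (a y)%:E)%E.
  rewrite -ge0_integralZl_EFin ?powR_ge0//; last 2 first.
  - by move=> y _; rewrite lee_fin.
  - by apply/measurable_EFinP; exact: measurable_funTS.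
  apply: ae_eq_integral_on; apply: filterS va => y vay Sy; rewrite (vay Sy).
  by rewrite EFinM.
have E2 : (\int[leb]_(y in S) ((v y `^ (- q)) `^ m%:R)%:E =
    ((V `^ q) ^+ m)%:E * \int[leb]_(y in S) (a y ^+ m)%:E)%E.
  rewrite -ge0_integralZl_EFin ?exprn_ge0 ?powR_ge0//; last 2 first.
  - by move=> y _; rewrite lee_fin exprn_ge0.
  - by apply/measurable_EFinP; apply: measurable_funTS; exact: measurable_funX.
  apply: ae_eq_integral_on; apply: filterS va => y vay Sy; rewrite (vay Sy).
  by rewrite powR_mulrn ?mulr_ge0 ?powR_ge0// exprMn EFinM.
rewrite E1 E2.
have a1 : (\int[leb]_(y in S) (a y)%:E <= 1)%E.
  apply: le_trans (power_density_integral q1E V0 (muS _ mS) uV).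
  rewrite [leLHS]integral_mkcond; apply: ge0_le_integral_any => y _.
    by apply: erestrict_ge0 => y' _; rewrite lee_fin.
  by rewrite patchE; case: ifPn => // _; rewrite lee_fin; exact: (a0 y).
have X0 : (0 <= \int[leb]_(y in S) (a y)%:E)%E by apply: integral_ge0 => y _; rewrite lee_fin.
have Y0 : (0 <= \int[leb]_(y in S) (a y ^+ m)%:E)%E.
  by apply: integral_ge0 => y _; rewrite lee_fin exprn_ge0.
set X := (\int[leb]_(y in S) (a y)%:E)%E in a1 X0 *.
set Y := (\int[leb]_(y in S) (a y ^+ m)%:E)%E in Y0 *.
have Vq : 0 < V `^ q by exact: powR_gt0.
move=> H.
have {}H : ((B^-1%:E * (((V `^ q) ^+ m)%:E * Y)) `^ m%:R^-1 <= (C * B^-1 * V `^ q)%:E)%E.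
  apply: le_trans H _.
  apply: (@le_trans _ _ (C%:E * (B^-1%:E * ((V `^ q)%:E * X)))%E).
    rewrite lee_wpmul2r//; first by rewrite !mule_ge0// lee_fin ?invr_ge0 ltW.
    by rewrite lee_fin ler_norm.
  rewrite !muleA -!EFinM -[leRHS]mule1 lee_wpmul2l// lee_fin.
  by rewrite !mulr_ge0// ?invr_ge0 ltW.
have mR : m%:R != 0 :> R by rewrite pnatr_eq0 gtn_eqF.
have {}H : (B^-1%:E * (((V `^ q) ^+ m)%:E * Y) <= ((C * B^-1 * V `^ q) ^+ m)%:E)%E.
  have T0 : (0 <= B^-1%:E * (((V `^ q) ^+ m)%:E * Y))%E.
    by rewrite !mule_ge0// lee_fin ?invr_ge0 ?exprn_ge0// ltW.
  have CB : 0 <= C * B^-1 * V `^ q by rewrite !mulr_ge0// ?invr_ge0 ltW.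
  rewrite -[leLHS]poweRe1// -(mulVf mR) poweRrM -(powR_mulrn m CB).
  rewrite -poweR_EFin; apply: gt0_ler_poweR => //.
  - by rewrite in_itv/= leey poweR_ge0.
  - by rewrite in_itv/= leey andbT lee_fin.
have BE : B * (C * B^-1 * V `^ q) ^+ m = (V `^ q) ^+ m * (C ^+ m * B^-1 ^+ m.-1).
  have -> : B^-1 ^+ m.-1 = B * B^-1 ^+ m.
    by rewrite -[in RHS](prednK m0) exprS mulrA divff ?mul1r// gt_eqF.
  rewrite !exprMn; move: (B^-1 ^+ m) (C ^+ m) ((V `^ q) ^+ m) => s t s'; ring.
have YB : (Y <= (C ^+ m * B^-1 ^+ m.-1)%:E)%E.
  have Vm : 0 < (V `^ q) ^+ m by rewrite exprn_gt0.
  rewrite -(@lee_pmul2l _ ((V `^ q) ^+ m)%:E) ?fin_numE// ?lte_fin// -EFinM -BE EFinM.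
  have -> : (((V `^ q) ^+ m)%:E * Y = B%:E * (B^-1%:E * (((V `^ q) ^+ m)%:E * Y)))%E.
    by rewrite muleA -EFinM divff ?mul1e// gt_eqF.
  by rewrite lee_wpmul2l// lee_fin ltW.
apply: le_trans (lee_wpmul2l _ YB) _; first by rewrite lee_fin !exprn_ge0// ltW.
rewrite -EFinM lee_fin mulrCA [leRHS]mulrC ler_wpM2l ?exprn_ge0//.
rewrite -exprMn lerXn2r ?nnegrE ?mulr_ge0 ?exprn_ge0 ?invr_ge0 ?(ltW vol0) ?(ltW rho0)//.
rewrite ler_pdivrMr//.
have := bvol_ge z r20; rewrite -/B mulrC mulrAC divfK// expr_div_n ler_pdivrMr ?exprn_gt0//.
by rewrite mulrC.
Qed.

End reverse_hoelder_bound.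

(** * The difference of two values of the commutator *)

Lemma ae_forall_ord d (T : measurableType d) (R : realType)
    (mu : {measure set T -> \bar R}) k (P : 'I_k -> T -> Prop) :
  (forall i, {ae mu, forall x, P i x}) -> {ae mu, forall x, forall i, P i x}.
Proof.
move=> H; have /ae_foralln : forall j : nat, {ae mu, forall x, forall i : 'I_k, i = j :> nat -> P i x}.
  move=> j; have [jk|kj] := ltnP j k.
    apply: filterS (H (Ordinal jk)) => x Px i ij.
    by have -> : i = Ordinal jk by apply: val_inj.
  by apply: aeW => x i ij; have := ltn_ord i; rewrite ij ltnNge kj.
by apply: filterS => x Px i; exact: Px.
Qed.

Lemma ae_le_integral_tensor3 d (T : measurableType d) (R : realType)
    (mu : {sigma_finite_measure set T -> \bar R}) (k : nat) (C c : R)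
    (h1 h2 h3 : 'I_k -> T -> R) (D : k.-tuple T -> R) : 0 <= C -> 0 <= c ->
  (forall i, measurable_fun [set: T] (h1 i)) -> (forall i t, 0 <= h1 i t) ->
  (forall i, measurable_fun [set: T] (h2 i)) -> (forall i t, 0 <= h2 i t) ->
  (forall i, measurable_fun [set: T] (h3 i)) -> (forall i t, 0 <= h3 i t) ->
  (forall y, 0 <= D y) ->
  {ae tuple_measure mu k, forall y, D y <= C * (c * \prod_(i < k) h1 i (tnth y i) +
     \prod_(i < k) h2 i (tnth y i) + \prod_(i < k) h3 i (tnth y i))} ->
  (\int[tuple_measure mu k]_y (D y)%:E <=
   C%:E * (c%:E * \prod_(i < k) \int[mu]_t (h1 i t)%:E +
     \prod_(i < k) \int[mu]_t (h2 i t)%:E + \prod_(i < k) \int[mu]_t (h3 i t)%:E))%E.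
Proof.
move=> C0 c0 m1 h10 m2 h20 m3 h30 D0 DP.
rewrite -(tuple_measure_tensor mu m1 h10) -(tuple_measure_tensor mu m2 h20).
rewrite -(tuple_measure_tensor mu m3 h30).
set P1 := fun y : k.-tuple T => \prod_(i < k) h1 i (tnth y i) in DP *.
set P2 := fun y : k.-tuple T => \prod_(i < k) h2 i (tnth y i) in DP *.
set P3 := fun y : k.-tuple T => \prod_(i < k) h3 i (tnth y i) in DP *.
have mP1 : measurable_fun [set: k.-tuple T] P1 by exact: measurable_tprod_gen.
have mP2 : measurable_fun [set: k.-tuple T] P2 by exact: measurable_tprod_gen.
have mP3 : measurable_fun [set: k.-tuple T] P3 by exact: measurable_tprod_gen.
have P10 y : 0 <= P1 y by apply: prodr_ge0.
have P20 y : 0 <= P2 y by apply: prodr_ge0.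
have P30 y : 0 <= P3 y by apply: prodr_ge0.
have mcP1 : measurable_fun [set: k.-tuple T] (fun y => c * P1 y) by exact: measurable_funM.
have mS : measurable_fun [set: k.-tuple T] (fun y => c * P1 y + P2 y).
  exact: measurable_funD.
have -> : (c%:E * \int[tuple_measure mu k]_y (P1 y)%:E +
    \int[tuple_measure mu k]_y (P2 y)%:E + \int[tuple_measure mu k]_y (P3 y)%:E =
    \int[tuple_measure mu k]_y (c * P1 y + P2 y + P3 y)%:E)%E.
  under [RHS]eq_integral do rewrite EFinD.
  rewrite ge0_integralD//.
  - congr (_ + _)%E; under [RHS]eq_integral do rewrite EFinD EFinM.
    rewrite ge0_integralD//.
    + congr (_ + _)%E; rewrite ge0_integralZl_EFin//.
      * by move=> y _; rewrite lee_fin.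
      * exact/measurable_EFinP.
    + by move=> y _; rewrite -EFinM lee_fin mulr_ge0.
    + by apply/measurable_EFinP.
    + by move=> y _; rewrite lee_fin.
    + exact/measurable_EFinP.
  - by move=> y _; rewrite lee_fin addr_ge0 ?mulr_ge0.
  - exact/measurable_EFinP.
  - by move=> y _; rewrite lee_fin.
  - exact/measurable_EFinP.
rewrite -ge0_integralZl_EFin//; last 2 first.
- by move=> y _; rewrite lee_fin !addr_ge0 ?mulr_ge0.
- by apply/measurable_EFinP; exact: measurable_funD.
apply: ae_ge0_le_integral_any.
- by move=> y _; rewrite lee_fin.
- by move=> y _; rewrite -EFinM lee_fin mulr_ge0// !addr_ge0 ?mulr_ge0.
- by apply: filterS DP => y Dy _; rewrite -EFinM lee_fin.
Qed.

Section key_estimate.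
Context {R : realType} {n m : nat}.
Implicit Types (x z : Rn R n) (y : m.-tuple (Rn R n)).
Local Notation leb := (@lebn R n).
Local Notation "p ^*" := (hoelder_conjugate p) : ereal_scope.

Variables (al ga dl : R) (K : Rn R n -> m.-tuple (Rn R n) -> R).
Variables (b : 'I_m -> Rn R n -> R) (p : 'I_m -> \bar R) (be : 'I_m -> R).
Hypotheses (m0 : (0 < m)%N) (al0 : 0 < al) (al_lt : al < (m * n)%:R) (dl0 : 0 < dl)
  (dlga : dl < ga) (al_dl : al + dl < (m * n)%:R).
Hypotheses (Ksize : kernel_size al K) (Ksmooth : kernel_smooth al ga K).
Hypothesis bL : forall i, Lipschitz_space dl (b i).
Hypothesis p1 : forall i, (1 <= p i)%E.
Hypothesis pn : ((n%:R / (al + dl))%:E < (\sum_(i < m) (p i)^-1)^-1)%E.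
Hypotheses (be_n : forall i, be i < n%:R) (sum_be : \sum_i be i = al + dl).

Let e i := n%:R - be i + dl / m%:R.

Let n0 : (0 < n)%N.
Proof.
rewrite lt0n; apply: contraTneq al_lt => ->; by rewrite muln0 -leNgt ltW.
Qed.

Let e0 i : 0 < e i.
Proof. by rewrite addr_gt0 ?subr_gt0// divr_gt0// ltr0n. Qed.

Let sum_e : \sum_i e i = (m * n)%:R - al.
Proof.
have -> : \sum_i e i = \sum_(i < m) n%:R - \sum_i be i + \sum_(i < m) dl / m%:R.
  by rewrite -sumrB -big_split.
rewrite sum_be !sumr_const card_ord -[n%:R *+ m]mulr_natr -[(dl / _) *+ m]mulr_natr.
by rewrite divfK ?natrM ?pnatr_eq0 ?gtn_eqF//; ring.
Qed.

(** The main estimate.  The functions are written [g i * u i], where [g i] is in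
    [L^(p i)] with norm at most [N i] and [u i] is the inverse of a weight.  The
    numbers [Q i] bound the norms of [u i] that appear in the class of weights,
    and the last hypothesis is the conclusion of [reverse_hoelder_density]. *)
Lemma commutator_difference_le (c0 : R) : 0 <= c0 ->
  exists2 M : R, 1 <= M & exists2 C : R, 0 < C &
  forall z (r : R) (g u : 'I_m -> Rn R n -> R) (N Q : 'I_m -> R), 0 < r ->
    let rho := 2 * (M * r) in let S := eball z (rho / 2) in
    (forall i, measurable_fun [set: Rn R n] (g i)) ->
    (forall i, measurable_fun [set: Rn R n] (u i)) ->
    (forall i, 0 < N i) -> (forall i, 0 < Q i) ->
    (forall i, ('N[leb]_(p i)[EFin \o g i] <= (N i)%:E)%E) ->
    (forall i, ('N[leb]_((p i)^*)[EFin \o (fun t => u i t * (r + edist z t) `^ (- e i))%R]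
      <= (Q i)%:E)%E) ->
    (forall i (V : R), 0 < V -> ('N[leb]_((p i)^*)[EFin \o (fun t => u i t * \1_S t)%R] <= V%:E)%E ->
      (((rho ^+ n) ^+ m.-1)%:E *
      \int[leb]_(t in S) (power_density ((p i)^*)%E (u i t * \1_S t / V) ^+ m)%:E <= c0%:E)%E) ->
    exists W : Rn R n -> \bar R,
      [/\ measurable_fun [set: Rn R n] W, forall x, (0 <= W x)%E,
          (\int[leb]_(x in S) W x <= (C * r ^+ n)%:E)%E &
          forall x x', eball z r x -> eball z r x' ->
            (\int[lebmn]_y (`|commutator_kernel K b x y - commutator_kernel K b x' y| *
                            `|tprod (fun i t => g i t * u i t) y|)%:E <=
             (C * r `^ dl * \prod_(i < m) (N i * Q i))%:E * (1 + W x + W x'))%E].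
Proof.
move=> c00.
have at0 : 0 < al + dl by exact: addr_gt0.
have [sg sgn sum_th] := local_exponent m0 at0 al_dl p1 pn.
pose tau i := 1 - fine (p i)^-1%E + fine (p i)^-1%E / m%:R.
pose th i := sg * tau i.
have mR : 0 < (m%:R : R) by rewrite ltr0n.
have tau0 i : 0 < tau i.
  rewrite /tau; have [_ q0 q1] := fine_inve_itv (p1 i).
  have : 0 <= fine (p i)^-1%E / m%:R by rewrite divr_ge0// ltW.
  case: (eqVneq (fine (p i)^-1%E) 0) => [-> _|qn0]; first by rewrite mul0r; lra.
  have : 0 < fine (p i)^-1%E / m%:R by rewrite divr_gt0// lt0r qn0.
  by lra.
have th0 i : 0 <= th i.
  by rewrite mulr_ge0 ?(ltW (tau0 i))//; case/andP: sgn.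
have [M M1 [CD CD0 HCD]] := commutator_kernel_le m0 al_lt dl0 dlga Ksize
  Ksmooth bL be_n sum_be th0 sum_th.
have [Ml Ml0 HMl] := local_dominant m0 sgn c00.
have M0 : 0 < M by lra.
exists M => //; exists (CD * (2 ^+ m + (2 * M) `^ dl) + Ml * (2 * M) ^+ n).
  by rewrite addr_gt0 ?mulr_gt0 ?addr_gt0 ?exprn_gt0 ?powR_gt0 ?mulr_gt0.
move=> z r g u N Q r0 rho S mg mu_ N0 Q0 gN uQ RH.
have rho0 : 0 < rho by rewrite !mulr_gt0.
have SE : S = eball z (M * r) by rewrite /S /rho mulrC mulKf.
have mS : measurable S by exact: measurable_eball.
have r_rho : r <= M * r by rewrite ler_peMl// ltW.
(* On S the factor (r + |z - t|) ^ e i is at most rho ^ e i, so that V i bounds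
   the norm of u i on S. *)
pose V i := rho `^ e i * Q i.
have V0 i : 0 < V i by rewrite mulr_gt0// powR_gt0.
have muS i : measurable_fun [set: Rn R n] (fun t => u i t * \1_S t).
  by apply: measurable_funM.
have rd t : 0 < r + edist z t by rewrite ltr_pwDl.
have mwe i : measurable_fun [set: Rn R n] (fun t => (r + edist z t) `^ (- e i)).
  apply: (measurableT_comp (measurable_powR _)); apply: measurable_funD => //.
  exact: measurable_eudist.
have mue i : measurable_fun [set: Rn R n] (fun t => u i t * (r + edist z t) `^ (- e i)).
  exact: measurable_funM.
have pc1 i : (1 <= (p i)^*)%E by exact: hoelder_conj_ge1.
have uV i : ('N[leb]_((p i)^*)[EFin \o (fun t => u i t * \1_S t)%R] <= (V i)%:E)%E.
  apply: (le_trans (Lnorm_le_scale (pc1 i) (powR_gt0 (e i) rho0) (mue i) _)).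
    apply: aeW => t; rewrite !normrM (ger0_norm (powR_ge0 _ _)) mulrCA ler_wpM2l//.
    rewrite indicE; have [|_] := boolP (t \in S); last by rewrite normr0 mulr_ge0 ?powR_ge0.
    rewrite inE SE /eball/= normr1 => zt.
    rewrite powRN ler_pdivlMr ?powR_gt0// mul1r.
    rewrite ge0_ler_powR ?nnegrE ?(ltW (e0 i)) ?(ltW (rd t)) ?(ltW rho0)//.
    rewrite /rho; lra.
  by rewrite /V EFinM lee_wpmul2l// lee_fin powR_ge0.
pose A i t := power_density (p i) (g i t / N i).
pose Cc i t := power_density ((p i)^*)%E (u i t * \1_S t / V i).
have A0 i t : 0 <= A i t by exact: power_density_ge0.
have Cc0 i t : 0 <= Cc i t by exact: power_density_ge0.
have mA i : measurable_fun [set: Rn R n] (A i).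
  by apply: measurable_power_density; exact: measurable_funM.
have mCc i : measurable_fun [set: Rn R n] (Cc i).
  by apply: measurable_power_density; exact: measurable_funM.
have A1 i : (\int[leb]_t (A i t)%:E <= 1)%E by exact: power_density_integral.
have [W [mW W0 intW HW]] := HMl z rho A Cc rho0 mA A0 mCc Cc0 A1 (fun i => RH i (V i) (V0 i) (uV i)).
rewrite -/S in intW HW.
exists W; split => //.
  apply: le_trans intW _; rewrite lee_fin /rho mulrA exprMn mulrA ler_wpM2r ?exprn_ge0 ?(ltW r0)//.
  by rewrite lerDr mulr_ge0 ?addr_ge0 ?exprn_ge0 ?powR_ge0// ltW.
move=> x x' zx zx'.
pose af i t := `|g i t * u i t| * (r + edist z t) `^ (- e i).
pose bf x i t := `|g i t * u i t| * (\1_S t * edist x t `^ (- th i)).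
have af0 i t : 0 <= af i t by rewrite mulr_ge0 ?powR_ge0.
have bf0 x1 i t : 0 <= bf x1 i t by rewrite !mulr_ge0 ?powR_ge0.
have mgu i : measurable_fun [set: Rn R n] (fun t => `|g i t * u i t|).
  by apply: measurableT_comp => //; exact: measurable_funM.
have maf i : measurable_fun [set: Rn R n] (af i) by exact: measurable_funM.
have mbf x1 i : measurable_fun [set: Rn R n] (bf x1 i).
  apply: measurable_funM => //; apply: measurable_funM; first exact: measurable_indic.
  by apply: (measurableT_comp (measurable_powR _)); exact: measurable_eudist.
have leb0 : (0 < leb setT)%E by exact: lebn_setT_gt0.
have bound : (\int[lebmn]_y (`|commutator_kernel K b x y - commutator_kernel K b x' y| *
       `|tprod (fun i t => g i t * u i t) y|)%:E <=
    CD%:E * ((r `^ dl)%:E * \prod_(i < m) \int[leb]_t (af i t)%:E +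
      \prod_(i < m) \int[leb]_t (bf x i t)%:E + \prod_(i < m) \int[leb]_t (bf x' i t)%:E))%E.
  apply: ae_le_integral_tensor3 => //; rewrite ?powR_ge0 ?(ltW CD0)//.
  have neq x1 : {ae lebmn, forall y, forall i : 'I_m, 0 < edist x1 (tnth y i)}.
    apply: ae_forall_ord => i.
    exact: (@ae_tnth _ _ _ leb m i (fun t => 0 < edist x1 t) (ae_neq x1 n0)).
  apply: filterS2 (neq x) (neq x') => y xy x'y.
  have -> : \prod_(i < m) af i (tnth y i) = `|tprod (fun i t => g i t * u i t) y| *
      \prod_(i < m) (r + edist z (tnth y i)) `^ (- e i).
    by rewrite /af big_split/= normr_prod.
  have bfE x1 : \prod_(i < m) bf x1 i (tnth y i) = `|tprod (fun i t => g i t * u i t) y| *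
      \prod_(i < m) (\1_S (tnth y i) * edist x1 (tnth y i) `^ (- th i)).
    by rewrite /bf big_split/= normr_prod.
  rewrite !bfE SE.
  have := HCD z r x x' y r0 zx zx' xy x'y.
  move=> /(ler_wpM2r (normr_ge0 (tprod (fun i t => g i t * u i t) y))).
  move=> /le_trans; apply; rewrite le_eqVlt; apply/orP; left; apply/eqP; rewrite /e; ring.
have inta i : (\int[leb]_t (af i t)%:E <= (2 * (N i * Q i))%:E)%E.
  apply: (@le_trans _ _ (\int[leb]_t ((N i * Q i)%:E * ((A i t)%:E +
     (power_density ((p i)^*)%E (u i t * (r + edist z t) `^ (- e i) / Q i))%:E)))%E).
    apply: ae_ge0_le_integral_any.
    - by move=> t _; rewrite lee_fin.
    - move=> t _; rewrite -EFinD -EFinM lee_fin mulr_ge0 ?addr_ge0 ?power_density_ge0//.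
      by rewrite mulr_ge0 ?ltW.
    apply: filterS (ae_young leb0 (p1 i) m0 (N0 i) (Q0 i) (gN i) (uQ i)) => t /(_ 1 ler01) H _.
    move: H; rewrite !powR1 !mulr1 mulrA normrM (ger0_norm (powR_ge0 _ _)).
    by rewrite -EFinD -EFinM lee_fin.
  rewrite ge0_integralZl_EFin ?mulr_ge0 ?(ltW (N0 i)) ?(ltW (Q0 i))//; last 2 first.
  - by move=> t _; rewrite -EFinD lee_fin addr_ge0 ?power_density_ge0.
  - apply/measurable_EFinP; apply: measurable_funD => //.
    by apply: measurable_power_density; exact: measurable_funM.
  rewrite [2 * _]mulrC [leRHS]EFinM lee_wpmul2l ?lee_fin ?mulr_ge0 ?(ltW (N0 i)) ?(ltW (Q0 i))//.
  rewrite ge0_integralD//; last 4 first.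
  - by move=> t _; rewrite lee_fin.
  - exact/measurable_EFinP.
  - by move=> t _; rewrite lee_fin power_density_ge0.
  - by apply/measurable_EFinP; apply: measurable_power_density; exact: measurable_funM.
  have -> : 2 = 1 + 1 :> R by [].
  rewrite EFinD; apply: leeD; first exact: A1.
  exact: power_density_integral.
have intb x1 : S x1 -> (\prod_(i < m) \int[leb]_t (bf x1 i t)%:E <=
    (rho `^ dl * \prod_(i < m) (N i * Q i))%:E * W x1)%E.
  move=> Sx1; pose k := riesz_kernel sg rho S x1.
  pose c i := rho `^ (- th i) * (N i * V i).
  have c0' i : 0 <= c i.
    by rewrite mulr_ge0 ?powR_ge0// (mulr_ge0 (ltW (N0 i)) (ltW (V0 i))).
  have mk : measurable_fun [set: Rn R n] k by exact: measurable_riesz_kernel.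
  have k0 t : 0 <= k t by exact: riesz_kernel_ge0.
  have H0 i t : 0 <= A i t * k t `^ m%:R^-1 + Cc i t * k t.
    by rewrite addr_ge0// mulr_ge0 ?powR_ge0.
  have step i : (\int[leb]_t (bf x1 i t)%:E <= (c i)%:E *
      \int[leb]_t (A i t * k t `^ m%:R^-1 + Cc i t * k t)%:E)%E.
    rewrite -ge0_integralZl_EFin//; last 2 first.
    - by move=> t _; rewrite lee_fin.
    - apply/measurable_EFinP; apply: measurable_funD; apply: measurable_funM => //.
      exact: (measurableT_comp (measurable_powR _)).
    apply: ae_ge0_le_integral_any.
    - by move=> t _; rewrite lee_fin.
    - by move=> t _; rewrite -EFinM lee_fin mulr_ge0.
    apply: filterS2 (ae_neq x1 n0) (ae_young leb0 (p1 i) m0 (N0 i) (V0 i) (gN i) (uV i)).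
    move=> t xt /(_ (k t) (k0 t)); rewrite -/(tau i) => H _.
    rewrite -EFinM lee_fin /c -[leRHS]mulrA.
    apply: (@le_trans _ _ (rho `^ (- th i) * (`|g i t * (u i t * \1_S t)| * k t `^ tau i))); last first.
      by rewrite ler_wpM2l ?powR_ge0// -/(A i t) -/(Cc i t).
    rewrite /bf /k /riesz_kernel indicE.
    have [tS|_] := boolP (t \in S); last first.
      by rewrite !mul0r !mulr0 normr0 !mul0r mulr0.
    rewrite !mul1r !mulr1 mulrCA ler_wpM2l// -powRrM mulNr -/(th i).
    rewrite powRM ?invr_ge0 ?(ltW rho0)// -[X in _ * (_ * X `^ _)]powR_inv1 ?(ltW rho0)//.
    by rewrite -powRrM mulN1r opprK mulrCA -gt0_powRD// addNr powRr0 mulr1.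
  apply: (@le_trans _ _ (\prod_(i < m) ((c i)%:E *
     \int[leb]_t (A i t * k t `^ m%:R^-1 + Cc i t * k t)%:E))%E).
    by apply: lee_prod => // i; apply: integral_ge0 => t _; rewrite lee_fin.
  rewrite big_split/= prodEFin.
  have -> : \prod_(i < m) c i = rho `^ dl * \prod_(i < m) (N i * Q i).
    have -> : dl = \sum_(i < m) (- th i + e i).
      rewrite big_split/= sum_e sumrN sum_th; ring.
    rewrite powR_sum// -big_split/=; apply: eq_bigr => i _.
    by rewrite /c /V (gt0_powRD (- th i) (e i))// -!mulrA; congr (_ * _); rewrite mulrCA.
  rewrite lee_wpmul2l//; last exact: HW.
  by rewrite lee_fin mulr_ge0 ?powR_ge0// prodr_ge0// => i _; rewrite mulr_ge0 ?ltW.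
have Sx1 x1 : eball z r x1 -> S x1.
  by rewrite SE /eball/= => zx1; apply: lt_le_trans zx1 _.
set PNQ := \prod_(i < m) (N i * Q i) in intb *.
have PNQ0 : 0 <= PNQ by apply: prodr_ge0 => i _; rewrite mulr_ge0 ?ltW.
have inta' : (\prod_(i < m) \int[leb]_t (af i t)%:E <= (2 ^+ m * PNQ)%:E)%E.
  apply: (@le_trans _ _ (\prod_(i < m) (2 * (N i * Q i))%:E)%E).
    by apply: lee_prod => // i; apply: integral_ge0 => t _; rewrite lee_fin.
  by rewrite prodEFin big_split/= prodr_const card_ord.
apply: le_trans bound _.
apply: (@le_trans _ _ (CD%:E * ((r `^ dl)%:E * (2 ^+ m * PNQ)%:E +
   (rho `^ dl * PNQ)%:E * W x + (rho `^ dl * PNQ)%:E * W x'))%E).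
  rewrite lee_wpmul2l ?lee_fin ?(ltW CD0)//; apply: leeD; last exact/intb/Sx1.
  by apply: leeD; [rewrite lee_wpmul2l// lee_fin powR_ge0|exact/intb/Sx1].
set C1 := CD * (2 ^+ m + (2 * M) `^ dl).
have C10 : 0 <= C1 by rewrite mulr_ge0 ?addr_ge0 ?exprn_ge0 ?powR_ge0// ltW.
have rhoE : rho `^ dl = (2 * M) `^ dl * r `^ dl.
  by rewrite /rho mulrA powRM ?mulr_ge0 ?ltW.
apply: (@le_trans _ _ ((C1 * r `^ dl * PNQ)%:E * (1 + W x + W x'))%E).
  have rW x1 : (0 <= (rho `^ dl * PNQ)%:E * W x1)%E.
    by rewrite mule_ge0// lee_fin mulr_ge0 ?powR_ge0.
  have rP' : (0 <= (r `^ dl)%:E * (2 ^+ m * PNQ)%:E)%E.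
    by rewrite mule_ge0// lee_fin ?mulr_ge0 ?powR_ge0 ?exprn_ge0.
  rewrite !ge0_muleDr ?adde_ge0//.
  rewrite mule1 !muleA -!EFinM.
  have rP : 0 <= r `^ dl * PNQ by rewrite mulr_ge0 ?powR_ge0.
  have Cle1 : CD * (r `^ dl * (2 ^+ m * PNQ)) <= C1 * r `^ dl * PNQ.
    have -> : CD * (r `^ dl * (2 ^+ m * PNQ)) = CD * 2 ^+ m * (r `^ dl * PNQ) by ring.
    by rewrite -[leRHS]mulrA ler_wpM2r// ler_wpM2l ?(ltW CD0)// lerDl powR_ge0.
  have Cle2 : CD * (rho `^ dl * PNQ) <= C1 * r `^ dl * PNQ.
    have -> : CD * (rho `^ dl * PNQ) = CD * (2 * M) `^ dl * (r `^ dl * PNQ) by rewrite rhoE; ring.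
    by rewrite -[leRHS]mulrA ler_wpM2r// ler_wpM2l ?(ltW CD0)// lerDr exprn_ge0.
  apply: leeD; first apply: leeD; first by rewrite lee_fin -[leLHS]mulrA.
  - by rewrite lee_wpmul2r.
  - by rewrite lee_wpmul2r.
rewrite lee_wpmul2r ?adde_ge0// lee_fin -[leLHS]mulrA -[leRHS]mulrA ler_wpM2r ?mulr_ge0 ?powR_ge0//.
by rewrite lerDl mulr_ge0 ?exprn_ge0 ?mulr_ge0// ltW.
Qed.

End key_estimate.

(** * Mean oscillation and representatives of the commutator *)

Lemma ae_exists d (T : measurableType d) (R : realType)
    (mu : {measure set T -> \bar R}) (B : set T) (P : T -> Prop) : measurable B ->
  (0 < mu B)%E -> {ae mu, forall x, B x -> P x} -> exists2 x, B x & P x.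
Proof.
move=> mB B0 [N [mN N0 PN]]; apply: contrapT => nP.
have BN : B `<=` N by move=> x Bx; apply: PN => /= Px; apply: nP; exists x => //; exact: Px.
by move: B0; rewrite (subset_measure0 _ _ BN N0)// ltxx.
Qed.

Section oscillation.
Context {R : realType} {n : nat}.
Implicit Types (x z : Rn R n) (r : R).
Local Notation leb := (@lebn R n).

(** A function whose differences on a ball are dominated by [1 + W x + W x'] is
    integrable there, with mean oscillation controlled by the integral of [W]. *)
Lemma oscillation_le z r (F : Rn R n -> R) (A eta : R) (W : Rn R n -> \bar R) :
  0 < r -> 0 <= A -> measurable_fun [set: Rn R n] W -> (forall x, (0 <= W x)%E) ->
  (\int[leb]_(x in eball z r) W x <= eta%:E)%E -> ae_measurable leb F ->
  {ae leb, forall x, eball z r x -> {ae leb, forall x', eball z r x' ->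
    (`|F x - F x'|%:E <= A%:E * (1 + W x + W x'))%E}} ->
  (\int[leb]_(x in eball z r) `|F x|%:E < +oo)%E /\
  (\int[leb]_(x in eball z r) `|F x - baverage F z r|%:E <=
     (A * (bvol z r + 2 * eta))%:E)%E.
Proof.
move=> r0 A0 mW W0 intW [G mG FG] HF.
set B := eball z r in intW HF *; have mB : measurable B by exact: measurable_eball.
have volE : leb B = (bvol z r)%:E by rewrite bvolE.
have vol0 : 0 < bvol z r by exact: bvol_gt0.
set vol := bvol z r in volE vol0 *.
have eta0 : 0 <= eta.
  by rewrite -lee_fin; apply: le_trans intW; apply: integral_ge0 => x _.
have mWB : measurable_fun B W by exact: measurable_funTS.
have Wfin : {ae leb, forall x, B x -> W x \is a fin_num}.
  apply: integrable_ae => //; apply/integrableP; split => //.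
  under eq_integral do rewrite gee0_abs//.
  by apply: le_lt_trans intW _; rewrite ltry.
have intcst (c : R) : (\int[leb]_(x in B) c%:E = (c * vol)%:E)%E.
  by rewrite EFinM -volE; exact: integral_cst.
have intc (c a : R) : 0 <= c -> 0 <= a ->
    (\int[leb]_(x in B) (c%:E + a%:E * W x) <= (c * vol + a * eta)%:E)%E.
  move=> c0 a0; rewrite ge0_integralD//; last 2 first.
  - by move=> x _; rewrite mule_ge0.
  - exact: measurable_funeM.
  rewrite intcst EFinD leeD2l//.
  rewrite ge0_integralZl_EFin//.
  by rewrite EFinM lee_wpmul2l.
have HG : {ae leb, forall x, B x -> W x \is a fin_num /\
    {ae leb, forall x', B x' -> (`|G x - G x'|%:E <= A%:E * (1 + W x + W x'))%E}}.
  apply: filterS3 (FG) HF Wfin => x /(_ I) Fx Hx Wx Bx; split; first exact: Wx.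
  apply: filterS2 FG (Hx Bx) => x' /(_ I) Fx' Hx' Bx'.
  by rewrite -Fx -Fx'; exact: Hx'.
have [x0 Bx0 [Wx0 Hx0]] : exists2 x0, B x0 & W x0 \is a fin_num /\
    {ae leb, forall x', B x' -> (`|G x0 - G x'|%:E <= A%:E * (1 + W x0 + W x'))%E}.
  have B0 : (0 < leb B)%E by rewrite volE lte_fin.
  exact: (ae_exists mB B0 HG).
have FGB (h : R -> R) : (\int[leb]_(x in B) (h (F x))%:E = \int[leb]_(x in B) (h (G x))%:E)%E.
  by apply: ae_eq_integral_on; apply: filterS FG => x /(_ I) ->.
have fineW x : W x \is a fin_num -> 0 <= fine (W x) by move=> _; exact: fine_ge0.
have split_bound x x' : W x \is a fin_num ->
   (A%:E * (1 + W x + W x') = (A * (1 + fine (W x)))%:E + A%:E * W x')%E.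
  move=> Wx; rewrite ge0_muleDr ?adde_ge0//; congr (_ + _)%E.
  by rewrite -{1}(fineK Wx) -EFinD -EFinM.
have mGB : measurable_fun B G by exact: measurable_funTS.
have Goo : (\int[leb]_(x in B) `|G x|%:E < +oo)%E.
  apply: (@le_lt_trans _ _ (\int[leb]_(x in B)
      ((`|G x0| + A * (1 + fine (W x0)))%:E + A%:E * W x))%E).
    apply: ae_ge0_le_integral_any.
    - by move=> x _; rewrite lee_fin.
    - move=> x _; rewrite adde_ge0 ?mule_ge0// lee_fin addr_ge0// mulr_ge0// addr_ge0//.
      exact: fineW.
    apply: filterS Hx0 => x' Hx' Bx'.
    apply: (@le_trans _ _ (`|G x0|%:E + `|G x0 - G x'|%:E)%E).
      by rewrite -EFinD lee_fin; have := ler_normB (G x0) (G x0 - G x');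
        rewrite opprB addrC subrK.
    rewrite EFinD -addeA leeD2l// -(split_bound x0 x')//; exact: Hx'.
  apply: le_lt_trans (intc _ _ _ A0) _; last by rewrite ltry.
  by rewrite addr_ge0// mulr_ge0// addr_ge0// fineW.
have iG : leb.-integrable B (EFin \o G).
  by apply/integrableP; split; [exact/measurable_EFinP|exact: Goo].
split; first by rewrite (FGB (fun t => `|t|)).
set avg := baverage F z r.
have avgE : avg * vol = fine (\int[leb]_(x in B) (G x)%:E).
  rewrite /avg /baverage -/vol -/B mulrAC mulVf ?mul1r ?gt_eqF//.
  by rewrite /Rintegral (FGB id).
have Gavg x : B x -> W x \is a fin_num ->
    {ae leb, forall x', B x' -> (`|G x - G x'|%:E <= A%:E * (1 + W x + W x'))%E} ->
    (`|G x - avg|%:E <= (A * (1 + eta / vol))%:E + A%:E * W x)%E.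
  move=> Bx Wx Hx.
  have ic : leb.-integrable B (EFin \o (fun=> G x)).
    apply/integrableP; split; first exact/measurable_EFinP.
    by rewrite /= intcst ltry.
  have E : (G x - avg) * vol = fine (\int[leb]_(x' in B) (G x - G x')%:E).
    under eq_integral do rewrite EFinB.
    rewrite integralB//.
    rewrite fineB ?integrable_fin_num// mulrBl avgE; congr (_ - _).
    by rewrite intcst.
  have : (`|(G x - avg) * vol|%:E <= (A * (1 + fine (W x)) * vol + A * eta)%:E)%E.
    have mD : measurable_fun B (fun x' => (G x - G x')%:E).
      by apply/measurable_EFinP; exact: measurable_funB.
    have iD : leb.-integrable B (fun x' => (G x - G x')%:E).
      by have := integrableB mB ic iG; apply: eq_integrable.
    rewrite E -fine_abse ?integrable_fin_num// fineK ?abse_fin_num ?integrable_fin_num//.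
    apply: le_trans (le_abse_integral _ mB mD) _.
    apply: le_trans (_ : \int[leb]_(x' in B) ((A * (1 + fine (W x)))%:E + A%:E * W x') <= _)%E; last first.
      by apply: intc => //; rewrite mulr_ge0// addr_ge0// fineW.
    apply: ae_ge0_le_integral_any => //.
      move=> x' _; rewrite adde_ge0 ?mule_ge0// lee_fin mulr_ge0// addr_ge0//; exact: fineW.
    by apply: filterS Hx => x' Hx' Bx'; rewrite -(split_bound x x')//; exact: Hx'.
  rewrite !lee_fin normrM (gtr0_norm vol0) => H.
  rewrite -(fineK Wx) -EFinM -EFinD lee_fin -(ler_pM2r vol0).
  apply: le_trans H _; rewrite le_eqVlt; apply/orP; left; apply/eqP.
  by field; rewrite gt_eqF.
rewrite (FGB (fun t => `|t - avg|)).
apply: (@le_trans _ _ (\int[leb]_(x in B) ((A * (1 + eta / vol))%:E + A%:E * W x))%E).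
  apply: ae_ge0_le_integral_any.
  - by move=> x _; rewrite lee_fin.
  - move=> x _; rewrite adde_ge0 ?mule_ge0// lee_fin mulr_ge0// addr_ge0//.
    by rewrite divr_ge0// ltW.
  by apply: filterS HG => x Hx Bx; have [? ?] := Hx Bx; exact: Gavg.
apply: le_trans (intc _ _ _ A0) _.
  by rewrite mulr_ge0// addr_ge0// divr_ge0// ltW.
rewrite lee_fin le_eqVlt; apply/orP; left; apply/eqP.
by field; rewrite gt_eqF.
Qed.

Lemma inv_weight_ball_gt0 (w : Rn R n -> R) z r : 0 < r ->
  locally_integrable_n (fun x => (w x)^-1) -> {ae leb, forall x, 0 < w x} ->
  0 < inv_weight_ball w z r.
Proof.
move=> r0 [[g mg wg] wloc] w0; have {wloc} := wloc z r r0.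
set B := eball z r; have mB : measurable B by exact: measurable_eball.
have E1 : (\int[leb]_(y in B) `|(w y)^-1|%:E = \int[leb]_(y in B) `|(g y)%:E|)%E.
  by apply: ae_eq_integral_on; apply: filterS wg => y /(_ I) ->.
have E2 : (\int[leb]_(y in B) ((w y)^-1)%:E = \int[leb]_(y in B) `|(g y)%:E|)%E.
  apply: ae_eq_integral_on; apply: filterS2 w0 wg => y w0 /(_ I) <- _.
  by rewrite abse_EFin gtr0_norm// invr_gt0.
rewrite E1 => oo; rewrite /inv_weight_ball /Rintegral E2 fine_gt0// oo andbT.
have I0 : (0 <= \int[leb]_(y in B) `|(g y)%:E|)%E by exact: integral_ge0.
rewrite lt0e I0 andbT; apply/eqP => J0.
have H : ae_eq leb B (EFin \o g) (cst 0%E).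
  apply/ae_eq_integral_abs => //.
  by apply/measurable_EFinP; exact: measurable_funTS.
have [y By //] : exists2 y, B y & False.
  have B0 : (0 < leb B)%E by rewrite /B -(bvolE z r0) lte_fin bvol_gt0.
  apply: (@ae_exists _ _ _ leb B _ mB B0).
  apply: filterS3 H w0 wg => y H' wy /(_ I) wgy By.
  have /= [g0] := H' By.
  by have := wy; rewrite -invr_gt0 wgy g0 ltxx.
Qed.

End oscillation.

(** A quantitative form of the continuity at [0] of [\prod_i (a i + e)]. *)
Lemma prod_add_le (R : realType) (I : Type) (s : seq I) (a : I -> R) (e : R) :
  (forall i, 0 <= a i) -> 0 <= e -> e <= 1 ->
  \prod_(i <- s) (a i + e) <= \prod_(i <- s) a i + e * \prod_(i <- s) (a i + 1).
Proof.
move=> a0 e0 e1; elim: s => [|i s IH]; first by rewrite !big_nil mulr1 lerDl.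
rewrite !big_cons.
have P1 : \prod_(j <- s) (a j + e) <= \prod_(j <- s) (a j + 1).
  by apply: ler_prod => j _; rewrite addr_ge0//= lerD2l.
set X := \prod_(j <- s) (a j + e) in IH P1 *; set Y := \prod_(j <- s) a j in IH *.
set Z := \prod_(j <- s) (a j + 1) in IH P1 *.
have := ler_wpM2l (a0 i) IH; have := ler_wpM2l e0 P1; lra.
Qed.

Lemma measurable_Rintegral_slice d1 d2 (T1 : measurableType d1) (T2 : measurableType d2)
    (R : realType) (m2 : {sigma_finite_measure set T2 -> \bar R}) (h : T1 * T2 -> R) :
  measurable_fun [set: T1 * T2] h ->
  measurable_fun [set: T1] (fun x => \int[m2]_y h (x, y)).
Proof.
move=> mh; apply: (measurableT_comp (fine_measurable measurableT)).
have mH : measurable_fun [set: T1 * T2] (fun z => (h z)%:E) by exact/measurable_EFinP.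
rewrite (_ : (fun x => _) = fun x => (fubini_F m2 ((fun z => (h z)%:E)^\+)%E x -
    fubini_F m2 ((fun z => (h z)%:E)^\-)%E x)%E); last first.
  apply/funext => x; rewrite integralE; congr (_ - _)%E.
    by apply: eq_integral => y _; rewrite !funeposE.
  by apply: eq_integral => y _; rewrite !funenegE.
apply: emeasurable_funB.
  by apply: measurable_fun_fubini_tonelli_F => //; exact: measurable_funepos.
by apply: measurable_fun_fubini_tonelli_F => //; exact: measurable_funeneg.
Qed.

Lemma ae_integrable_normr_Rintegral d (T : measurableType d) (R : realType)
    (mu : {measure set T -> \bar R}) (f : T -> R) : ae_integrable mu f ->
  (`|\int[mu]_x f x|%:E <= \int[mu]_x `|f x|%:E)%E.
Proof.
move=> /ae_integrableP[g ig fg]; rewrite (ae_eq_Rintegral fg).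
have -> : (\int[mu]_x `|f x|%:E = \int[mu]_x `|(g x)%:E|)%E.
  by apply: ae_eq_integral_any; exact: (ae_eq_comp (fun r : R => `|r|%:E) fg).
rewrite /Rintegral -fine_abse ?integrable_fin_num// fineK ?abse_fin_num ?integrable_fin_num//.
by apply: le_abse_integral => //; case/integrableP: ig.
Qed.

Section representatives.
Context {R : realType} {n m : nat}.
Implicit Types (x : Rn R n) (y : m.-tuple (Rn R n)).
Local Notation leb := (@lebn R n).

Variables (K : Rn R n -> m.-tuple (Rn R n) -> R) (b f : 'I_m -> Rn R n -> R).
Variables (Kt : Rn R n * m.-tuple (Rn R n) -> R) (ft : 'I_m -> Rn R n -> R).
Hypotheses (mb : forall j, measurable_fun [set: Rn R n] (b j))
  (mKt : measurable_fun setT Kt)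
  (mft : forall j, measurable_fun [set: Rn R n] (ft j))
  (fft : forall j, ae_eq leb setT (f j) (ft j)).

(* Kt and ft are Borel versions of K and f; x is a good point for the kernel when
   K x and Kt (x, _) agree almost everywhere. *)
Let slice x := ae_eq lebmn setT (K x) (fun y => Kt (x, y)).

Let D x x' y := (commutator_kernel K b x y - commutator_kernel K b x' y) * tprod f y.

Let Ktx x y := Kt (x, y).

Let Dt x x' y := (commutator_kernel Ktx b x y - commutator_kernel Ktx b x' y) * tprod ft y.

Lemma tprod_ae : ae_eq lebmn setT (tprod f) (tprod ft).
Proof.
have : {ae lebmn, forall y, forall i : 'I_m, f i (tnth y i) = ft i (tnth y i)}.
  apply: ae_forall_ord => i.
  apply: (@ae_tnth _ _ _ leb m i (fun t => f i t = ft i t)).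
  by apply: filterS (fft i) => t /(_ I).
by apply: filterS => y H _; rewrite /tprod; apply: eq_bigr => i _; exact: H.
Qed.

Lemma kernel_difference_ae x x' : slice x -> slice x' -> ae_eq lebmn setT (D x x') (Dt x x').
Proof.
move=> sx sx'; apply: filterS3 sx sx' tprod_ae => y /(_ I) Kx /(_ I) Kx' /(_ I) fy _.
by rewrite /D /Dt fy /commutator_kernel /Ktx Kx Kx'.
Qed.

Lemma measurable_commutator_kernel d (T : measurableType d)
    (g : T -> Rn R n) (h : T -> m.-tuple (Rn R n)) :
  measurable_fun [set: T] g -> measurable_fun [set: T] h ->
  measurable_fun [set: T] (fun t => commutator_kernel Ktx b (g t) (h t)).
Proof.
move=> mg mh; rewrite /commutator_kernel; apply: measurable_sum => j.
apply: measurable_funM.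
  apply: measurable_funB; first exact: (measurableT_comp (mb j) mg).
  apply: (measurableT_comp (mb j)).
  exact: (measurableT_comp (measurable_tnth j) mh).
by apply: (measurableT_comp mKt); exact/measurable_fun_pair.
Qed.

Lemma measurable_kernel_difference d (T : measurableType d)
    (g g' : T -> Rn R n) (h : T -> m.-tuple (Rn R n)) :
  measurable_fun [set: T] g -> measurable_fun [set: T] g' -> measurable_fun [set: T] h ->
  measurable_fun [set: T] (fun t => Dt (g t) (g' t) (h t)).
Proof.
move=> mg mg' mh; apply: measurable_funM.
  by apply: measurable_funB; exact: measurable_commutator_kernel.
exact: (measurableT_comp (measurable_tprod_gen mft) mh).
Qed.

Lemma kernel_difference_ae_measurable x x' : slice x -> slice x' ->
  ae_measurable lebmn (D x x').
Proof.
move=> sx sx'; exists (Dt x x'); last exact: kernel_difference_ae.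
exact: (@measurable_kernel_difference _ _ (fun=> x) (fun=> x') id).
Qed.

(** Up to a constant, [F] is the integral of a Borel function of two variables. *)
Lemma is_commutator_ae_measurable F : {ae leb, forall x, slice x} ->
  is_commutator K b f F -> ae_measurable leb F.
Proof.
move=> aes FC.
have [x0 _ [s0 F0]] : exists2 x0, setT x0 & slice x0 /\ {ae leb, forall x',
    ae_integrable lebmn (D x0 x') /\ F x0 - F x' = \int[lebmn]_y D x0 x' y}.
  apply: (@ae_exists _ _ _ leb) => //; first exact: lebn_setT_gt0.
  by apply: filterS2 aes FC.
exists (fun x' => F x0 - \int[lebmn]_y Dt x0 x' y).
  apply: measurable_funB => //.
  apply: (@measurable_Rintegral_slice _ _ _ _ _ lebmn (fun z => Dt x0 z.1 z.2)).
  exact: (@measurable_kernel_difference _ _ (fun=> x0)).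
apply: filterS2 aes F0 => x' s' [_ Fx'] _.
by rewrite -(ae_eq_Rintegral (kernel_difference_ae s0 s')) -Fx' opprB addrC subrK.
Qed.

(** The representative is [x |-> \int D x x0 y], normalized at a generic point
    [x0]. *)
Lemma is_commutator_exists (G : Rn R n -> Prop) : {ae leb, forall x, G x} ->
  (forall x x', G x -> G x' -> ae_integrable lebmn (D x x')) ->
  exists F, is_commutator K b f F.
Proof.
move=> aeG GD.
have [x0 _ G0] : exists2 x0, setT x0 & G x0.
  apply: (@ae_exists _ _ _ leb) => //; first exact: lebn_setT_gt0.
  by apply: filterS aeG.
exists (fun x => \int[lebmn]_y D x x0 y).
apply: filterS (aeG) => x Gx; apply: filterS (aeG) => x' Gx' /=.
split; first exact: GD.
have [_ <-] := ae_integrableB (GD _ _ Gx G0) (GD _ _ Gx' G0).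
congr (fine (integral _ _ _)); apply/funext => y; congr EFin; rewrite /D; ring.
Qed.

End representatives.

(** * The estimate on balls *)

Lemma prode_lty (R : realType) (k : nat) (f : 'I_k -> \bar R) :
  (forall i, (0 < f i)%E) -> (\prod_(i < k) f i < +oo)%E ->
  forall i, f i \is a fin_num.
Proof.
move=> f0 foo i; rewrite fin_numElt (lt_trans _ (f0 i)) ?ltNyr//=.
rewrite ltey; apply/eqP => fi; move: foo; rewrite (bigD1 i)//= fi gt0_mulye ?ltxx//.
by elim/big_ind : _ => // x y x0 y0; exact: mule_gt0.
Qed.

Lemma ae_eq_inv_weight (R : realType) n (v : Rn R n -> R) : weight v ->
  exists2 u : Rn R n -> R, measurable_fun [set: Rn R n] u &
    ae_eq (@lebn R n) setT (fun x => (v x)^-1) u.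
Proof.
move=> [[[vt mvt vvt] _] v0]; exists (fun x => vt x `^ (-1)).
  exact: (measurableT_comp (measurable_powR _) mvt).
apply: filterS2 vvt v0 => x /(_ I) <- v0 _.
by rewrite powR_inv1// ltW.
Qed.

(** The powers of the volume cancel: [vol] is comparable to [r ^+ n], and the
    hypothesis on [PQ] is the condition defining the class of weights. *)
Lemma oscillation_constant (R : realType) (n : nat)
    (r vol iw dl dt CH C1 E PN PQ c : R) :
  (0 < n)%N -> 0 < r -> 0 < vol -> 0 < iw -> 0 < c -> 0 <= dl -> 0 <= C1 -> 0 <= E ->
  0 <= PN -> 0 <= PQ -> 0 <= CH -> c * r ^+ n <= vol ->
  vol `^ (1 + (dl - dt) / n%:R) / iw * PQ <= CH ->
  (iw * vol `^ (dt / n%:R))^-1 *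
    (C1 * r `^ dl * (PN * (E * PQ)) * (vol + 2 * (C1 * r ^+ n))) <=
  C1 * E * CH * c `^ (- (dl / n%:R)) * (1 + 2 * C1 / c) * PN.
Proof.
move=> n0 r0 vol0 iw0 c0 dl0 C10 E0 PN0 PQ0 CH0 cr H.
have nR : 0 < (n%:R : R) by rewrite ltr0n.
have rn : r ^+ n <= vol / c by rewrite ler_pdivlMr// mulrC.
have rdl : r `^ dl <= c `^ (- (dl / n%:R)) * vol `^ (dl / n%:R).
  have -> : r `^ dl = (r ^+ n) `^ (dl / n%:R).
    by rewrite -powR_mulrn ?(ltW r0)// -powRrM mulrCA divff ?mulr1// gt_eqF.
  have -> : c `^ (- (dl / n%:R)) = c^-1 `^ (dl / n%:R).
    by rewrite -(powR_inv1 (ltW c0)) -powRrM mulN1r.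
  rewrite -powRM ?invr_ge0 ?(ltW c0) ?(ltW vol0)// [_^-1 * _]mulrC.
  by rewrite ge0_ler_powR ?nnegrE ?exprn_ge0 ?divr_ge0 ?(ltW r0) ?(ltW vol0) ?(ltW c0) ?(ltW nR).
pose X := vol `^ (1 + (dl - dt) / n%:R) / iw * PQ.
have X0 : 0 <= X by rewrite mulr_ge0// divr_ge0 ?powR_ge0// ltW.
have -> : (iw * vol `^ (dt / n%:R))^-1 *
    (C1 * r `^ dl * (PN * (E * PQ)) * (vol + 2 * (C1 * r ^+ n))) =
    X * (C1 * E * PN) * (vol `^ (- (1 + dl / n%:R)) * (r `^ dl * (vol + 2 * (C1 * r ^+ n)))).
  have -> : vol `^ (- (1 + dl / n%:R)) = (vol `^ (1 + (dl - dt) / n%:R))^-1 * (vol `^ (dt / n%:R))^-1.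
    by rewrite -!powRN -gt0_powRD//; congr (_ `^ _); field; rewrite gt_eqF.
  rewrite /X; have := powR_gt0 (1 + (dl - dt) / n%:R) vol0.
  have := powR_gt0 (dt / n%:R) vol0.
  move: (vol `^ _) (vol `^ _) => s t s0 t0.
  by field; rewrite !gt_eqF.
have -> : C1 * E * CH * c `^ (- (dl / n%:R)) * (1 + 2 * C1 / c) * PN =
    CH * (C1 * E * PN) * (c `^ (- (dl / n%:R)) * (1 + 2 * C1 / c)) by ring.
apply: ler_pM.
- by rewrite (mulr_ge0 X0)// !mulr_ge0.
- by rewrite !mulr_ge0 ?powR_ge0// addr_ge0 ?(ltW vol0)// !mulr_ge0// exprn_ge0// ltW.
- by rewrite ler_wpM2r// !mulr_ge0.
have -> : c `^ (- (dl / n%:R)) * (1 + 2 * C1 / c) = vol `^ (- (1 + dl / n%:R)) *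
    (c `^ (- (dl / n%:R)) * vol `^ (dl / n%:R) * (vol + 2 * (C1 * (vol / c)))).
  have E1 : vol `^ (- (1 + dl / n%:R)) * vol `^ (dl / n%:R) = vol^-1.
    by rewrite -gt0_powRD// -(powR_inv1 (ltW vol0)); congr (_ `^ _); ring.
  rewrite (_ : _ * (_ * _ * _) = c `^ (- (dl / n%:R)) *
    (vol `^ (- (1 + dl / n%:R)) * vol `^ (dl / n%:R)) * (vol + 2 * (C1 * (vol / c)))); last by ring.
  by rewrite E1; field; rewrite !gt_eqF.
rewrite ler_wpM2l ?powR_ge0//; apply: ler_pM => //; first exact: powR_ge0.
  by rewrite addr_ge0 ?(ltW vol0)// !mulr_ge0// exprn_ge0// ltW.
by rewrite lerD2l ler_wpM2l// ler_wpM2l.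
Qed.

Section ball_bound.
Context {R : realType} {n m : nat}.
Implicit Types (x z : Rn R n) (r : R).
Local Notation leb := (@lebn R n).
Local Notation "p ^*" := (hoelder_conjugate p) : ereal_scope.

Variables (al ga dl dt : R) (K : Rn R n -> m.-tuple (Rn R n) -> R) (p : 'I_m -> \bar R)
    (b : 'I_m -> Rn R n -> R) (w : Rn R n -> R) (v : 'I_m -> Rn R n -> R).
Hypotheses (m0 : (0 < m)%N) (n0 : (0 < n)%N) (al0 : 0 < al) (al_lt : al < (m * n)%:R)
  (dl0 : 0 < dl) (dlga : dl < ga) (al_dl : al + dl < (m * n)%:R)
  (Ksize : kernel_size al K) (Ksmooth : kernel_smooth al ga K)
  (p1 : forall i, (1 <= p i)%E)
  (pn : ((n%:R / (al + dl))%:E < (\sum_(i < m) (p i)^-1)^-1)%E)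
  (bL : forall i, Lipschitz_space dl (b i))
  (ww : weight w) (wv : forall i, weight (v i))
  (Hpw : weight_class_H dl p (al + dl) dt w v)
  (RH : forall i, (1 < p i)%E -> (1 < m)%N ->
    reverse_holder m%:R (fun x => v i x `^ (- fine (hoelder_conjugate (p i))))).

(** The data [A], [eta] and [W] needed by [oscillation_le], with the resulting
    bound of the mean oscillation.  The numbers [N i] are positive upper bounds of
    the norms, since a norm may vanish. *)
Lemma commutator_ball_bound : exists2 C : R, 0 < C &
  forall (f : 'I_m -> Rn R n -> R) (N : 'I_m -> R),
    (forall i, ae_measurable leb (fun x => f i x * v i x)) -> (forall i, 0 < N i) ->
    (forall i, ('N[leb]_(p i)[EFin \o (fun x => f i x * v i x)%R] <= (N i)%:E)%E) ->
    forall z r, 0 < r -> exists (A eta : R) (W : Rn R n -> \bar R),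
      [/\ 0 <= A, measurable_fun [set: Rn R n] W, forall x, (0 <= W x)%E &
          [/\ (\int[leb]_(x in eball z r) W x <= eta%:E)%E,
          forall x x', eball z r x -> eball z r x' ->
            (\int[lebmn]_y `|(commutator_kernel K b x y - commutator_kernel K b x' y) *
               tprod f y|%:E <= A%:E * (1 + W x + W x'))%E &
          (inv_weight_ball w z r * bvol z r `^ (dt / n%:R))^-1 * (A * (bvol z r + 2 * eta)) <=
            C * \prod_(i < m) N i]].
Proof.
have [wloc [be [be0n sum_be [CH CH0 HCH]]]] := Hpw.
have be_n i : be i < n%:R by case/andP: (be0n i).
have v0 i : {ae leb, forall x, 0 < v i x} by case: (wv i).
have /choice[u uP] : forall i, exists u : Rn R n -> R, measurable_fun [set: Rn R n] u /\
    ae_eq leb setT (fun x => (v i x)^-1) u.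
  by move=> i; have [u] := ae_eq_inv_weight (wv i); exists u.
have mu_ i : measurable_fun [set: Rn R n] (u i) by case: (uP i).
have vu i : ae_eq leb setT (fun x => (v i x)^-1) (u i) by case: (uP i).
have /choice[c0 c0P] : forall i, exists c0 : R, 0 <= c0 /\
    forall z (rho V : R), 0 < rho -> 0 < V -> let S := eball z (rho / 2) in
    ('N[leb]_((p i)^*)[EFin \o (fun y => u i y * \1_S y)%R] <= V%:E)%E ->
    (((rho ^+ n) ^+ m.-1)%:E *
      \int[leb]_(y in S) (power_density ((p i)^*)%E (u i y * \1_S y / V) ^+ m)%:E <= c0%:E)%E.
  move=> i; have [c0 c00 H] := reverse_hoelder_density m0 (p1 i) (v0 i) (mu_ i) (vu i) (@RH i).
  by exists c0.
pose c := \sum_i c0 i.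
have c00 i : 0 <= c0 i by case: (c0P i).
have cc : 0 <= c by exact: sumr_ge0.
have c0c i : c0 i <= c by rewrite /c (bigD1 i)//= lerDl sumr_ge0.
have [M M1 [C1 C10 HC1]] := commutator_difference_le m0 al0 al_lt dl0 dlga al_dl
  Ksize Ksmooth bL p1 pn be_n sum_be cc.
have M0 : 0 < M by lra.
pose e i := n%:R - be i + dl / m%:R.
have e0 i : 0 < e i by rewrite addr_gt0 ?subr_gt0// divr_gt0// ltr0n.
pose E : R := \prod_(i < m) 2 `^ e i.
have E0 : 0 < E by apply: prodr_gt0 => i _; exact: powR_gt0.
pose kap : R := (2 / n.+1%:R) ^+ n.
have kap0 : 0 < kap by rewrite exprn_gt0// divr_gt0.
exists (C1 * E * CH * kap `^ (- (dl / n%:R)) * (1 + 2 * C1 / kap)).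
  rewrite mulr_gt0 ?addr_gt0 ?divr_gt0 ?mulr_gt0 ?powR_gt0//.
move=> f N mfv N0 fN z r r0.
have vol0 := bvol_gt0 z r0; set vol := bvol z r in vol0 *.
have iw0 : 0 < inv_weight_ball w z r by apply: inv_weight_ball_gt0 => //; case: ww.
set iw := inv_weight_ball w z r in iw0 *.
(* The product of the norms Qh i is finite and each of them is positive, hence
   each is finite. *)
pose q i (y : Rn R n) := (v i y)^-1 / (vol `^ n%:R^-1 + edist z y) `^ e i.
pose Qh i := 'N[leb]_((p i)^*)[EFin \o q i]%E.
have vn0 : 0 < vol `^ n%:R^-1 by exact: powR_gt0.
have base0 y : 0 < vol `^ n%:R^-1 + edist z y by rewrite ltr_pwDl.
pose qt i y := u i y * (vol `^ n%:R^-1 + edist z y) `^ (- e i).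
have mqt i : measurable_fun [set: Rn R n] (qt i).
  apply: measurable_funM => //; apply: (measurableT_comp (measurable_powR _)).
  by apply: measurable_funD => //; exact: measurable_eudist.
have qqt i : ae_eq leb setT (q i) (qt i).
  by apply: filterS (vu i) => y /(_ I) vuy _; rewrite /q /qt vuy powRN.
have pc1 i : (1 <= (p i)^*)%E by exact: hoelder_conj_ge1.
have Qh0 i : (0 < Qh i)%E.
  apply: Lnorm_gt0 => //; first exact: lebn_setT_gt0.
    by exists (qt i).
  by apply: filterS (v0 i) => y vy; rewrite divr_gt0 ?invr_gt0 ?powR_gt0.
have HH : ((vol `^ (1 + (dl - dt) / n%:R) / iw)%:E * \prod_(i < m) Qh i <= CH%:E)%E.
  exact: HCH.
have co0 : 0 < vol `^ (1 + (dl - dt) / n%:R) / iw by rewrite divr_gt0// powR_gt0.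
have Qoo : (\prod_(i < m) Qh i < +oo)%E.
  rewrite ltey; apply/eqP => Qy; move: HH; rewrite Qy gt0_muley ?lte_fin//.
have Qfin := prode_lty Qh0 Qoo.
pose Q i := 2 `^ e i * fine (Qh i).
have Q0 i : 0 < Q i by rewrite mulr_gt0 ?powR_gt0// fine_gt0// Qh0 ltey_eq Qfin.
have bvol_root : vol `^ n%:R^-1 <= 2 * r.
  have := bvol_le z r0; rewrite -/vol => H.
  apply: (@le_trans _ _ (((2 * r) ^+ n) `^ n%:R^-1)).
    by rewrite ge0_ler_powR ?nnegrE ?invr_ge0 ?exprn_ge0 ?mulr_ge0 ?(ltW r0) ?(ltW vol0).
  rewrite -powR_mulrn ?mulr_ge0 ?(ltW r0)// -powRrM divff ?powRr1 ?mulr_ge0 ?(ltW r0)//.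
  by rewrite pnatr_eq0 gtn_eqF.
have uQ i : ('N[leb]_((p i)^*)[EFin \o (fun t => u i t * (r + edist z t) `^ (- e i))%R]
    <= (Q i)%:E)%E.
  rewrite /Q EFinM fineK// /Qh (ae_eq_Lnorm _ (ae_eq_comp EFin (qqt i))).
  apply: Lnorm_le_scale => //.
  apply: aeW => y; rewrite /qt !normrM !(ger0_norm (powR_ge0 _ _)) mulrCA ler_wpM2l//.
  rewrite -powR_half//; apply: ler_powRN; rewrite ?(ltW (e0 i)) ?divr_gt0//.
  have := eudist_ge0 z y; lra.
have /choice[g gP] : forall i, exists g : Rn R n -> R, measurable_fun [set: Rn R n] g /\
    ae_eq leb setT (fun x => f i x * v i x) g.
  by move=> i; have [g] := mfv i; exists g.
have mg i : measurable_fun [set: Rn R n] (g i) by case: (gP i).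
have fg i : ae_eq leb setT (fun x => f i x * v i x) (g i) by case: (gP i).
have gN i : ('N[leb]_(p i)[EFin \o g i] <= (N i)%:E)%E.
  by rewrite -(ae_eq_Lnorm _ (ae_eq_comp EFin (fg i))).
have fgu i : ae_eq leb setT (f i) (fun x => g i x * u i x).
  apply: filterS3 (fg i) (vu i) (v0 i) => x /(_ I) <- /(_ I) <- vx _.
  by rewrite mulfK// gt_eqF.
have rho0 : 0 < 2 * (M * r) by rewrite !mulr_gt0.
have RHc i (V : R) : 0 < V -> let S := eball z (2 * (M * r) / 2) in
   ('N[leb]_((p i)^*)[EFin \o (fun t => u i t * \1_S t)%R] <= V%:E)%E ->
   ((((2 * (M * r)) ^+ n) ^+ m.-1)%:E *
    \int[leb]_(t in S) (power_density ((p i)^*)%E (u i t * \1_S t / V) ^+ m)%:E <= c%:E)%E.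
  move=> V0 S uV; have [_ H] := c0P i.
  by apply: le_trans (H z _ V rho0 V0 uV) _; rewrite lee_fin.
have [W [mW W0 intW HW]] := HC1 z r g u N Q r0 mg mu_ N0 Q0 gN uQ RHc.
exists (C1 * r `^ dl * \prod_(i < m) (N i * Q i)), (C1 * r ^+ n), W; split => //.
  by rewrite !mulr_ge0 ?powR_ge0 ?(ltW C10)// prodr_ge0// => i _; rewrite mulr_ge0 ?ltW.
split.
- apply: le_trans intW; apply: ge0_subset_integral => //.
    by apply: measurable_funTS.
  move=> x; rewrite /eball/= [2 * _]mulrC mulfK// => zx.
  by apply: lt_le_trans zx _; rewrite ler_peMl// ltW.
- move=> x x' zx zx'; apply: le_trans (HW x x' zx zx').
  rewrite le_eqVlt; apply/orP; left; apply/eqP; apply: ae_eq_integral_any.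
  apply: filterS (tprod_ae fgu) => y /(_ I) fy _.
  by rewrite normrM fy.
have PQ0 : 0 <= \prod_(i < m) fine (Qh i) by apply: prodr_ge0 => i _; rewrite fine_ge0// ltW.
have PN0 : 0 <= \prod_(i < m) N i by apply: prodr_ge0 => i _; exact: ltW.
have -> : \prod_(i < m) (N i * Q i) = \prod_(i < m) N i * (E * \prod_(i < m) fine (Qh i)).
  by rewrite big_split/= /Q big_split.
apply: oscillation_constant => //; try exact: ltW.
- have := bvol_ge z r0; rewrite -/vol; apply: le_trans.
  by rewrite /kap -exprMn le_eqVlt; apply/orP; left; apply/eqP; congr (_ ^+ _); ring.
- rewrite -lee_fin EFinM -prodEFin; apply: le_trans HH.
  rewrite le_eqVlt; apply/orP; left; apply/eqP; congr (_ * _)%E.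
  by apply: eq_bigr => i _; rewrite fineK.
Qed.

End ball_bound.

(** * The theorem *)

Theorem theorem1p1 (R : realType) (n m : nat) (al ga dl dt : R)
    (K : Rn R n -> m.-tuple (Rn R n) -> R) (p : 'I_m -> \bar R)
    (b : 'I_m -> Rn R n -> R) (w : Rn R n -> R) (v : 'I_m -> Rn R n -> R) :
  0 < al < (m * n)%:R ->
  0 < ga <= 1 ->
  kernel_measurable K ->
  kernel_size al K ->
  kernel_smooth al ga K ->
  0 < dl < Num.min ga ((m * n)%:R - al) ->
  (forall i, 1 <= p i)%E ->
  ((n%:R / (al + dl))%:E < (\sum_(i < m) (p i)^-1)^-1)%E ->
  (forall i, Lipschitz_space dl (b i)) ->
  dt <= dl ->
  weight w ->
  (forall i, weight (v i)) ->
  weight_class_H dl p (al + dl) dt w v ->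
  (* RH_1 imposes no condition *)
  (forall i, (1 < p i)%E -> (1 < m)%N ->
    reverse_holder m%:R
      (fun x => v i x `^ (- fine (hoelder_conjugate (p i))))) ->
  exists2 C : R, 0 < C &
    forall f : 'I_m -> Rn R n -> R,
      (forall i, Lp_space lebn (p i) (fun x => f i x * v i x)) ->
      (exists F, is_commutator K b f F) /\
      forall F, is_commutator K b f F ->
        weighted_Lipschitz_space w dt F /\
        forall (x : Rn R n) (r : R), 0 < r ->
          (wlip_oscillation w dt F x r <=
           C%:E * \prod_(i < m)
                    'N[lebn]_(p i)[EFin \o (fun x => f i x * v i x)%R])%E.
Proof.
move=> /andP[al0 al_lt] _ [Kt mKt KKt] Ksize Ksmooth /andP[dl0] + p1 pn bL _ ww wv Hpw RH.
rewrite lt_min => /andP[dlga dlmn].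
have al_dl : al + dl < (m * n)%:R by rewrite addrC -ltrBrDr.
have mn0 : (0 < m * n)%N by rewrite -(ltr_nat R); exact: lt_trans al_lt.
have m0 : (0 < m)%N by move: mn0; rewrite muln_gt0 => /andP[].
have n0 : (0 < n)%N by move: mn0; rewrite muln_gt0 => /andP[].
have [C C0 HC] := commutator_ball_bound m0 n0 al0 al_lt dl0 dlga al_dl Ksize Ksmooth p1 pn
  bL ww wv Hpw RH.
have mb j : measurable_fun [set: Rn R n] (b j) by exact: Lipschitz_measurable dl0 (bL j).
exists C => // f fL.
set leb := @lebn R n.
have mfv i : ae_measurable leb (fun x => f i x * v i x) by case: (fL i).
pose nf i := 'N[leb]_(p i)[EFin \o (fun x => f i x * v i x)%R]%E.
have nf0 i : (0 <= nf i)%E by exact: Lnorm_ge0.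
have nffin i : nf i \is a fin_num by rewrite ge0_fin_numE//; case: (fL i).
pose a i := fine (nf i).
have a0 i : 0 <= a i by exact: fine_ge0.
have nfa i : nf i = (a i)%:E by rewrite fineK.
have /choice[ft ftP] : forall i, exists ft : Rn R n -> R, measurable_fun [set: Rn R n] ft /\
    ae_eq leb setT (f i) ft.
  move=> i; have [u mu_ vu] := ae_eq_inv_weight (wv i).
  have [g mg fg] := mfv i; exists (fun x => g x * u x); split; first exact: measurable_funM.
  case: (wv i) => _; apply: filterS3 fg vu => x /(_ I) <- /(_ I) <- vx _.
  by rewrite mulfK// gt_eqF.
have mft i : measurable_fun [set: Rn R n] (ft i) by case: (ftP i).
have fft i : ae_eq leb setT (f i) (ft i) by case: (ftP i).
have slices : {ae leb, forall x, ae_eq lebmn setT (K x) (fun y => Kt (x, y))}.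
  have /ae_xsection : {ae (leb \x lebmn)%E, forall z, K z.1 z.2 = Kt z}.
    by apply: filterS KKt => z /(_ I).
  by apply: filterS => x; apply: filterS => y.
pose D x x' y := (commutator_kernel K b x y - commutator_kernel K b x' y) * tprod f y.
split.
  have N0 i : 0 < a i + 1 by rewrite ltr_pwDr.
  have fN i : (nf i <= (a i + 1)%:E)%E by rewrite nfa lee_fin lerDl.
  (* The balls centered at z0 with radius k.+1 exhaust the space, and on each of
     them the dominating function W k is finite almost everywhere. *)
  pose z0 : Rn R n := [tuple 0 | i < n].
  have /choice[A HA] : forall k : nat, exists A : R, exists W : Rn R n -> \bar R,
     [/\ 0 <= A, {ae leb, forall x, eball z0 k.+1%:R x -> W x \is a fin_num},
        forall x, (0 <= W x)%E &
        forall x x', eball z0 k.+1%:R x -> eball z0 k.+1%:R x' ->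
            (\int[lebmn]_y `|D x x' y|%:E <= A%:E * (1 + W x + W x'))%E].
    move=> k; have k0 : 0 < k.+1%:R :> R by [].
    have [A [eta [W [A0 mW W0 [intW HW _]]]]] := HC f (fun i => a i + 1) mfv N0 fN z0 _ k0.
    exists A, W; split => //; apply: integrable_ae => //; apply/integrableP; split.
      exact: measurable_funTS.
    under eq_integral do rewrite gee0_abs//.
    by apply: le_lt_trans intW _; rewrite ltry.
  have /choice[W HW] := HA.
  pose G x := ae_eq lebmn setT (K x) (fun y => Kt (x, y)) /\
    forall k : nat, eball z0 k.+1%:R x -> W k x \is a fin_num.
  apply: (@is_commutator_exists _ _ _ K b f G).
    have /ae_foralln : forall k : nat, {ae leb, forall x, eball z0 k.+1%:R x -> W k x \is a fin_num}.
      by move=> k; case: (HW k).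
    by apply: filterS2 slices => x.
  move=> x x' [sx Wx] [sx' Wx']; split.
    exact: (kernel_difference_ae_measurable mb mKt mft fft sx sx').
  have [k xk] : exists k : nat, Num.max (edist z0 x) (edist z0 x') < k.+1%:R.
    exists (Num.truncn (Num.max (edist z0 x) (edist z0 x'))).
    exact: truncnS_gt.
  move: xk; rewrite gt_max => /andP[xk x'k].
  have [A0 _ W0 H] := HW k; apply: le_lt_trans (H x x' xk x'k) _.
  rewrite -(fineK (Wx k xk)) -(fineK (Wx' k x'k)) -!EFinD -EFinM; exact: ltry.
move=> F FC.
have mF : ae_measurable leb F := is_commutator_ae_measurable mb mKt mft fft slices FC.
have bound (e : R) z r : 0 < e -> 0 < r ->
   (\int[leb]_(x in eball z r) `|F x|%:E < +oo)%E /\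
   (wlip_oscillation w dt F z r <= (C * \prod_(i < m) (a i + e))%:E)%E.
  move=> e0 r0.
  have N0 i : 0 < a i + e by rewrite ltr_wpDl.
  have fN i : (nf i <= (a i + e)%:E)%E by rewrite nfa lee_fin lerDl ltW.
  have [A [eta [W [A0 mW W0 [intW HW osc]]]]] := HC f (fun i => a i + e) mfv N0 fN z r r0.
  have HF : {ae leb, forall x, eball z r x -> {ae leb, forall x', eball z r x' ->
      (`|F x - F x'|%:E <= A%:E * (1 + W x + W x'))%E}}.
    apply: filterS FC => x FCx xB; apply: filterS FCx => x' [Di ->] x'B.
    by apply: le_trans (ae_integrable_normr_Rintegral Di) _; exact: HW.
  have [Foo Fosc] := oscillation_le r0 A0 mW W0 intW mF HF; split => //.
  rewrite /wlip_oscillation; apply: (@le_trans _ _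
    ((inv_weight_ball w z r * bvol z r `^ (dt / n%:R))^-1%:E * (A * (bvol z r + 2 * eta))%:E)%E).
    rewrite lee_wpmul2l// lee_fin invr_ge0 mulr_ge0 ?powR_ge0// ltW//.
    by apply: inv_weight_ball_gt0 => //; [case: Hpw|case: ww].
  by rewrite -EFinM lee_fin.
have P1 : 0 <= \prod_(i < m) (a i + 1) by apply: prodr_ge0 => i _; rewrite addr_ge0.
have final z r : 0 < r ->
    (wlip_oscillation w dt F z r <= (C * \prod_(i < m) a i)%:E)%E.
  move=> r0; apply/lee_addgt0Pr => eps eps0.
  set X := \prod_(i < m) (a i + 1) in P1.
  (* The norms are replaced by the positive numbers a i + e, and e is chosen so
     that the bound increases by at most eps. *)
  pose e := Num.min 1 (eps / (C * X + 1)).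
  have CX : 0 < C * X + 1 by rewrite ltr_wpDl// mulr_ge0// ltW.
  have e0 : 0 < e by rewrite lt_min ltr01 divr_gt0.
  have e1 : e <= 1 by rewrite ge_min lexx.
  apply: le_trans (bound e z r e0 r0).2 _; rewrite -EFinD lee_fin.
  apply: le_trans (ler_wpM2l (ltW C0) (prod_add_le (index_enum 'I_m) a0 (ltW e0) e1)) _.
  rewrite mulrDr lerD2l mulrCA.
  apply: (@le_trans _ _ (e * (C * X + 1))); first by rewrite ler_wpM2l ?ltW// ltrDl.
  by rewrite -ler_pdivlMr// /e ge_min lexx orbT.
split; last first.
  move=> z r r0; apply: le_trans (final z r r0) _.
  by rewrite EFinM -prodEFin lee_wpmul2l ?lee_fin ?(ltW C0)//; apply: lee_prod => i;
    rewrite ?lee_fin// -nfa.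
split; first by split => // z r r0; case: (bound 1 z r ltr01 r0).
by exists (C * \prod_(i < m) a i) => z r r0; exact: final.
Qed.
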